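(* Let $0\le\gamma\le1$ and $\epsilon>0$ be real numbers. Let $(d_i)_{i\in\mathbb{N}}$ and $(p_i)_{i\in\mathbb{N}}$ be sequences of primes such that $d_{i+1}\ge2d_i$ and $$d_i^{1-\gamma+\epsilon/2}\le\log p_i\le\log(2)+d_i^{1-\gamma+\epsilon/2}$$ for all $i\in\mathbb{N}$. Then the field $\mathbb{Q}(p_i^{1/d_i};\, i\in\mathbb{N})$ is $\gamma$-Northcott but not $(\gamma-\epsilon)$-Bogomolov.
   Context: $\mathbb{N}=\{1,2,3,\ldots\}$. $h$ is the absolute logarithmic Weil height on $\overline{\mathbb{Q}}$, $\deg\alpha=[\mathbb{Q}(\alpha):\mathbb{Q}]$, and for $\gamma\in\mathbb{R}$, $h_\gamma(\alpha)=(\deg\alpha)^\gamma h(\alpha)$. For $f:\overline{\mathbb{Q}}\to[0,\infty)$ and $S\subset\overline{\mathbb{Q}}$, $\mathcal{N}_f(S)=\inf\{X\in[0,\infty) : \#\{\alpha\in S : f(\alpha)<X\}=\infty\}$, with $\inf\emptyset=\infty$. Let $\mu\subset\overline{\mathbb{Q}}$ be the set of roots of unity. A set $S\subset\overline{\mathbb{Q}}$ is called $\gamma$-Bogomolov if $\mathcal{N}_{h_\gamma}(S\setminus\mu)>0$, and $\gamma$-Northcott if $\mathcal{N}_{h_\gamma}(S)=\infty$. For each $i$, $p_i^{1/d_i}$ denotes any choice of a $d_i$-th root of $p_i$. *)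

(* Defs.v *)
From HB Require Import structures.
From mathcomp Require Import all_boot all_order all_algebra all_field.
From mathcomp Require Import all_classical all_reals all_analysis.
Set Implicit Arguments.
Unset Strict Implicit.
Unset Printing Implicit Defensive.
Import Order.TTheory GRing.Theory Num.Theory.
Local Open Scope classical_set_scope.
Local Open Scope ring_scope.

(* The field of all algebraic numbers is [algC]. *)

Definition algdeg (a : algC) : nat := (size (minCpoly a)).-1.

(* The primitive polynomial over the integers with positive leading
   coefficient that is proportional to the minimal polynomial of [a]. *)
Definition int_minpoly (a : algC) : {poly int} :=
  zprimitive (projT1 (rat_poly_scale (s2val (minCpolyP a)))).

(* The conjugates of [a] over the rationals. *)
Definition conjugates (a : algC) : seq algC :=
  sval (closed_field_poly_normal (minCpoly a)).

(* The Mahler measure of [a]; the value is a real element of [algC]. *)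
Definition mahler (a : algC) : algC :=
  (lead_coef (int_minpoly a))%:~R * \prod_(b <- conjugates a) Num.max 1 `|b|.

(* The order embedding into R of the real algebraic numbers, by Dedekind cuts;
   it is meaningful only on [Num.real]. *)
Definition algC_to_real (R : realType) (x : algC) : R :=
  sup [set ratr q | q in [set q : rat | (ratr q : algC) <= x]].

(* The absolute logarithmic Weil height, log M(a) / deg a. *)
Definition weil_height (R : realType) (a : algC) : R :=
  ln (algC_to_real R (mahler a)) / (algdeg a)%:R.

Definition height_gamma (R : realType) (gamma : R) (a : algC) : R :=
  (algdeg a)%:R `^ gamma * weil_height R a.

(* [ereal_inf set0 = +oo], as the convention inf(empty) = oo requires. *)
Definition northcott_number (R : realType) (f : algC -> R) (S : set algC)
    : \bar R :=
  ereal_inf [set X%:E | X in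
    [set X : R | 0 <= X /\ infinite_set [set a | S a /\ f a < X]]].

Definition roots_of_unity : set algC :=
  [set a | exists n : nat, (0 < n)%N /\ a ^+ n = 1].

Definition Bogomolov (R : realType) (gamma : R) (S : set algC) : Prop :=
  (0 < northcott_number (height_gamma gamma) (S `\` roots_of_unity))%E.

Definition Northcott (R : realType) (gamma : R) (S : set algC) : Prop :=
  northcott_number (height_gamma gamma) S = +oo%E.

(* The subfield of [algC] generated by [A]; a subset closed under [1],
   subtraction and division is a subfield, and contains the rationals. *)
Definition generated_field (A : set algC) : set algC :=
  [set x | forall K : {pred algC}, divring_closed K ->
             (forall a, A a -> a \in K) -> x \in K].

(* Main.v *)
From mathcomp Require Import fingroup perm.
Require Import Defs.
From HB Require Import structures.
From mathcomp Require Import all_boot all_order all_algebra all_field.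
From mathcomp Require Import ring lra zify.
From mathcomp Require Import all_classical all_reals all_analysis.
Set Implicit Arguments.
Unset Strict Implicit.
Unset Printing Implicit Defensive.
Import Order.TTheory GRing.Theory Num.Theory.
Local Open Scope ring_scope.

(** Let K_i be the field generated by the radicals r_j with j < i. The theorem
rests on a lower bound for the height of the elements that appear at each step:
if i is large and a lies in K_(i+1) but not in K_i, then deg a >= d_i and

   h(a) >= log p_i / (2 d_i) - log d_i / (d_i - 1)

([radical_step] and [weil_height_ge]). After multiplication by (deg a)^gamma the
first term is at least d_i^(epsilon/2) / 2 and the second at most 2 log d_i, so
h_gamma(a) tends to infinity with i ([height_gamma_lower]). The elements that
remain lie in a single number field K_n, where degrees are bounded and the
classical theorem of Northcott applies ([finite_bounded_height]). On the other
hand r_i has degree d_i and Mahler measure p_i, so that h_(gamma - epsilon)(r_i)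
is at most (1 + log 2) d_i^(- epsilon/2), which tends to 0
([height_gamma_upper]).

The lower bound is the inequality of Silverman between the height of a and the
discriminant of a over K_i, made explicit for a Kummer step. Let L be a Galois
number field that contains r_0, ..., r_i and enough roots of unity, let G be its
Galois group, and let rho in G fix all the generators of L but r_i, which it
multiplies by a primitive root of unity of order d = d_i. The powers of rho give
conjugates a_0, ..., a_(d-1) of a over K_i, and the norm

   N = C^(d(d-1)) prod_(s in G) s (prod_(j < k) (a_k - a_j)),

where C is the leading coefficient of the primitive integer polynomial F whose
roots are the s(a), is a nonzero rational integer. Expanding the Vandermonde
determinant bounds |N| from above in terms of the Mahler measure of a
([conjugate_discriminant_le]); divisibility of a power of N by a power of p_i
bounds it from below ([conjugate_discriminant_ge]).

The divisibility is proved without prime ideals or valuations, in the ring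
[local_int] of the algebraic numbers that are integral at p = p_i. First, p is
unramified in the field generated by the other generators, which are all roots
of integers prime to p: an integral x of that field is divisible by p as soon as
a power of x is ([Kummer_unramified]). Hence the coordinates of an integral x of
L with respect to 1, r_i, ..., r_i^(d-1) are integral ([coordinate_local]), and
differences of conjugates of x under powers of rho are divisible by r_i
([gal_diff_local]). The element a itself need not be integral; but the quotient
F / (X - a) has integral coefficients, differences of its conjugates are
divisible by r_i, and the primitivity of F brings the information from these
polynomials back to N ([discriminant_identity], [primitive_polyOver]). *)

(** * Algebraic numbers that are integral at a prime *)

Lemma AintP (x : algC) : (x \in Aint) <-> integralOver (intr : int -> algC) x.
Proof.
split=> [/floorpP[q Dq]|[q mon_q qx0]].
  have := minCpoly_monic x; rewrite Dq !monicE lead_coef_map_inj //; last exact: intr_inj.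
  rewrite -[1]/(1%:~R) eqr_int -monicE => mon_q.
  by exists q; last by rewrite -Dq root_minCpoly.
apply: root_monic_Aint qx0 _ _; first exact: monic_map.
by apply/polyOverP=> i; rewrite coef_map /= intr_int.
Qed.

Lemma Aint_root_monic (q : {poly algC}) (x : algC) :
  q \is monic -> q \is a polyOver Aint -> root q x -> x \in Aint.
Proof.
move=> mon_q /polyOverP Aq qx0; apply/AintP.
apply: (integral_root_monic mon_q qx0); apply/integral_poly=> i.
exact/AintP.
Qed.

Lemma Aint_root (n : nat) (x : algC) : (0 < n)%N -> x ^+ n \in Aint -> x \in Aint.
Proof.
move=> n_gt0 Axn; apply: (@Aint_root_monic ('X^n - (x ^+ n)%:P)).
- exact: monicXnsubC.
- by rewrite rpredB ?rpredX ?polyOverX ?polyOverC.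
- by rewrite rootE !hornerE subrr.
Qed.

Section LocalIntegers.
Variables (p : nat) (p_pr : prime p).

(** The algebraic numbers integral over the localization of the integers at [p];
clearing the denominator [s] avoids building that localization. The proof that
[p] is prime is an argument because closure under sums depends on it. *)
Definition local_int of prime p : {pred algC} :=
  fun x => `[< exists2 s : nat, ~~ (p %| s)%N & s%:R * x \in Aint >].
Local Notation S := (local_int p_pr).

Lemma local_intP (x : algC) :
  reflect (exists2 s : nat, ~~ (p %| s)%N & s%:R * x \in Aint) (x \in S).
Proof. exact: asboolP. Qed.

Lemma Aint_local : {subset Aint <= S}.
Proof.
by move=> x Ax; apply/local_intP; exists 1%N; rewrite ?mul1r // dvdn1 neq_ltn prime_gt1 ?orbT.
Qed.

Fact local_int_subring : subring_closed S.
Proof.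
split=> [|x y /local_intP[s ps Ax] /local_intP[t pt Ay]|
  x y /local_intP[s ps Ax] /local_intP[t pt Ay]].
- exact/Aint_local/Aint1.
- apply/local_intP; exists (s * t)%N; first by rewrite Euclid_dvdM // negb_or ps.
  rewrite natrM mulrBr rpredB //.
    by rewrite mulrAC mulrC rpredM // rpred_nat.
  by rewrite -mulrA rpredM // rpred_nat.
- apply/local_intP; exists (s * t)%N; first by rewrite Euclid_dvdM // negb_or ps.
  by rewrite natrM mulrACA rpredM.
Qed.
HB.instance Definition _ := GRing.isSubringClosed.Build algC S local_int_subring.

Lemma local_int_unit (n : nat) : ~~ (p %| n)%N -> n%:R^-1 \in S.
Proof.
move=> pn; apply/local_intP; exists n => //.
rewrite divff ?rpred1 // pnatr_eq0; by case: n pn => //; rewrite dvdn0.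
Qed.

Lemma local_int_root (n : nat) (x : algC) : (0 < n)%N -> x ^+ n \in S -> x \in S.
Proof.
move=> n_gt0 /local_intP[s ps Ax]; apply/local_intP; exists s => //.
case: n n_gt0 Ax => // n n_gt0 Ax; apply: (Aint_root n_gt0).
by rewrite exprMn exprSr -mulrA rpredM // rpredX // rpred_nat.
Qed.

Lemma prime_natr_neq0 : p%:R != 0 :> algC.
Proof. by rewrite pnatr_eq0 -lt0n prime_gt0. Qed.

Lemma int_div_local (z : int) : p%:R^-1 * z%:~R \in S -> (p %| z)%Z.
Proof.
case/local_intP=> s ps; rewrite mulrCA => As.
have : (p%:R^-1 * (s%:R * z%:~R) : algC) \in Num.int.
  by apply: Cint_rat_Aint; rewrite ?As // rpredM ?rpredV ?rpred_nat // rpredM ?rpred_nat ?rpred_int.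
case/intrP=> m /(canRL (mulVKf prime_natr_neq0)) /eqP.
rewrite !pmulrn -!intrM eqr_int => /eqP Dm.
have: (p %| s%:Z * z)%Z by rewrite Dm dvdz_mulr.
by rewrite !dvdzE abszM /= Euclid_dvdM // (negPf ps).
Qed.

(** The field of rationals is unramified at [p]: there, divisibility of a power by
[p] passes to the base. *)
Lemma local_int_rat_radical (t : algC) (n : nat) :
  t \in Crat -> t \in S -> p%:R^-1 * t ^+ n \in S -> p%:R^-1 * t \in S.
Proof.
move=> Qt /local_intP[s ps As] Stn.
have /intrP[z Dz] : s%:R * t \in Num.int.
  by apply: Cint_rat_Aint; rewrite ?As // rpredM ?rpred_nat.
have s0: s%:R != 0 :> algC by rewrite pnatr_eq0; apply: contraNneq ps => ->.
have : p%:R^-1 * (z ^+ n)%:~R \in S.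
  by rewrite rmorphXn /= -Dz exprMn mulrCA rpredM // rpredX // rpred_nat.
move/int_div_local; case: n {Stn} => [|n].
  by rewrite expr0 dvdzE /= dvdn1 => /eqP p1; have := prime_gt1 p_pr; rewrite {1}p1.
rewrite dvdzE abszX /= Euclid_dvdX // andbT => /dvdnP[k Dk].
have -> : p%:R^-1 * t = s%:R^-1 * (sgz z * k)%:~R.
  have Ez : z = sgz z * k * p%:Z by rewrite {1}[z]intEsg Dk PoszM mulrA.
  rewrite -[t](mulKf s0) Dz mulrCA; congr (_ * _).
  by rewrite [in LHS]Ez intrM -pmulrn mulrC mulfK ?prime_natr_neq0.
by rewrite rpredM ?rpred_int ?local_int_unit.
Qed.

(** Nilpotent elements modulo [p] are stable under addition: in each term of the
binomial expansion one of the two exponents is large enough. *)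
Lemma local_int_radicalD (x y : algC) (m n : nat) :
    x \in S -> y \in S -> p%:R^-1 * x ^+ m \in S -> p%:R^-1 * y ^+ n \in S ->
  p%:R^-1 * (x + y) ^+ (m + n) \in S.
Proof.
move=> Sx Sy Sxm Syn; rewrite exprDn mulr_sumr rpred_sum // => -[i /= lti] _.
rewrite mulrnAr rpredMn //.
have [le_in|/ltnW le_ni] := leqP i n.
  have -> : (m + n - i = m + (n - i))%N by rewrite addnBA.
  by rewrite exprD mulrA mulrA rpredM ?rpredX // rpredM ?rpredX.
rewrite mulrCA rpredM ?rpredX // -(subnKC le_ni) exprD mulrA rpredM ?rpredX //.
Qed.

Lemma local_int_radical_sum (I : Type) (s : seq I) (P : pred I) (f : I -> algC) (n : nat) :
    (forall i, P i -> f i \in S) -> (forall i, P i -> p%:R^-1 * f i ^+ n \in S) ->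
  (0 < n)%N ->
  exists m, p%:R^-1 * (\sum_(i <- s | P i) f i) ^+ m \in S.
Proof.
move=> Sf Sfn n_gt0; elim: s => [|i s [m IH]].
  by exists n; rewrite big_nil expr0n eqn0Ngt n_gt0 mulr0 rpred0.
rewrite big_cons; case: ifP => Pi; last by exists m.
by exists (n + m)%N; apply: local_int_radicalD; rewrite ?Sf ?Sfn ?rpred_sum.
Qed.

(** A denominator that is both a power of [p] and prime to [p] is trivial, by
Bezout. *)
Lemma Aint_div_local (x : algC) (e : nat) :
  x \in Aint -> x / p%:R ^+ e \in S -> x / p%:R ^+ e \in Aint.
Proof.
move=> Ax /local_intP[s ps As].
have co: coprimez s (p ^ e)%N.
  by rewrite coprimezE /= coprimeXr // coprime_sym prime_coprime.
have [u [v Duv]] := Bezoutz s (p ^ e)%N; rewrite (eqP co) in Duv.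
have -> : x / p%:R ^+ e = u%:~R * (s%:R * (x / p%:R ^+ e)) + v%:~R * x.
  have D1 : u%:~R * s%:R + v%:~R * p%:R ^+ e = 1 :> algC.
    by rewrite -natrX !pmulrn -!intrM -intrD Duv.
  transitivity ((u%:~R * s%:R + v%:~R * p%:R ^+ e) * (x / p%:R ^+ e)).
    by rewrite D1 mul1r.
  rewrite mulrDl !mulrA; congr (_ + _).
  by rewrite mulrAC mulfK // expf_neq0 // prime_natr_neq0.
by apply: rpredD; apply: rpredM => //; apply: rpred_int.
Qed.

End LocalIntegers.

Lemma sum_expr_unity (R : idomainType) (m : nat) (z : R) : z ^+ m = 1 ->
  \sum_(k <- iota 0 m) z ^+ k = if z == 1 then m%:R else 0.
Proof.
move=> zm1; case: eqVneq => [->|z1].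
  by under eq_bigr do rewrite expr1n; rewrite big_const_seq count_predT size_iota iter_addr_0.
apply: (mulfI (x := z - 1)); first by rewrite subr_eq0.
by rewrite -[X in iota 0 X]subn0 -/(index_iota 0 m) big_mkord -subrX1 zm1 subrr mulr0.
Qed.

(** * Unramified Kummer extensions *)

Section NumberField.
Variables (L : splittingFieldType rat) (emb : {rmorphism L -> algC}).
Implicit Types (s : gal_of {:L}) (x : L).

Lemma galois_full : galois 1 {:L}.
Proof.
have [q q1 splq] := splittingPoly L.
apply/and3P; split; first exact: sub1v.
  apply/separableP=> y _; apply: pcharf0_separable.
  by move=> k; rewrite -(fmorph_pchar emb) pchar_num.
by apply/splitting_normalField; [exact: sub1v | exists q].
Qed.

Lemma fixed_rat x : (forall s, s x = x) -> emb x \in Crat.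
Proof.
move=> fx; have /vlineP[a ->] : x \in 1%VS.
  rewrite -(galois_fixedField galois_full).
  by apply/fixedFieldP=> [|s _]; [exact: memvf | exact: fx].
by rewrite rmorphZ_num rmorph1 mulr1 Crat_rat.
Qed.

Lemma gal_sum_rat x : emb (\sum_(s : gal_of {:L}) s x) \in Crat.
Proof.
apply: fixed_rat => t; rewrite rmorph_sum /=.
rewrite [RHS](reindex_inj (mulIg t)); apply: eq_bigr => s _.
by rewrite galM ?memvf.
Qed.

Lemma gal_prod_rat x : emb (\prod_(s : gal_of {:L}) s x) \in Crat.
Proof.
apply: fixed_rat => t; rewrite rmorph_prod /=.
rewrite [RHS](reindex_inj (mulIg t)); apply: eq_bigr => s _.
by rewrite galM ?memvf.
Qed.

(** Automorphisms of [L] extend to the algebraic numbers, where they preserve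
integrality. *)
Lemma Aint_gal s x : emb x \in Aint -> emb (s x) \in Aint.
Proof.
have [nu nuP] := extend_algC_subfield_aut emb s.
by rewrite nuP Aint_aut.
Qed.

Lemma local_int_gal p (p_pr : prime p) s x :
  emb x \in local_int p_pr -> emb (s x) \in local_int p_pr.
Proof.
case/local_intP=> n pn Ax; apply/local_intP; exists n => //.
by rewrite -(rmorph_nat emb) -rmorphM -(rmorph_nat s) -rmorphM Aint_gal // rmorphM rmorph_nat.
Qed.

Lemma gal_fixes_adjoin s (th : seq L) x :
  {in th, forall t, s t = t} -> x \in <<1 & th>>%VS -> s x = x.
Proof.
move=> fth; suff /subvP sub: (<<1 & th>> <= fixedSpace s)%VS.
  by move/sub/fixedSpaceP.
apply/Fadjoin_seqP; split; first exact: sub1v.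
by move=> t /fth/fixedSpaceP.
Qed.

Section Kummer.
Variables (p : nat) (p_pr : prime p) (m : nat).
Hypothesis (m_gt0 : (0 < m)%N) (pm : ~~ (p %| m)%N).

Definition unit_radical (t : L) :=
  exists2 u : nat, ~~ (p %| u)%N & t ^+ m = u%:R.

Fixpoint monomials (r : seq L) : seq L :=
  if r is t :: r' then [seq t ^+ k * w | k <- iota 0 m, w <- monomials r']
  else [:: 1].

Lemma unit_radical_neq0 t : unit_radical t -> t != 0.
Proof.
case=> u pu Dt; apply: contraNneq pu => t0.
move: Dt; rewrite t0 expr0n -[m == 0]negbK -lt0n m_gt0 /= => /esym/eqP.
rewrite -(fmorph_eq0 emb) rmorph_nat pnatr_eq0 => /eqP->; exact: dvdn0.
Qed.

Lemma unit_radical_local t : unit_radical t -> emb t \in local_int p_pr.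
Proof.
by case=> u pu Dt; apply: (local_int_root m_gt0); rewrite -rmorphXn Dt rmorph_nat rpred_nat.
Qed.

Lemma unit_radical_localV t : unit_radical t -> emb t^-1 \in local_int p_pr.
Proof.
case=> u pu Dt; apply: (local_int_root m_gt0).
by rewrite -rmorphXn exprVn Dt fmorphV rmorph_nat local_int_unit.
Qed.

Lemma monomials_ind (P : L -> Prop) (r : seq L) :
    P 1 -> (forall t w, t \in r -> P w -> P (t * w)) ->
  {in monomials r, forall w, P w}.
Proof.
move=> P1; elim: r => [_ w|t r IH Pr w] /=; first by rewrite inE => /eqP->.
case/allpairsP=> -[k y] /= [_ my ->{w}].
have Py : P y by apply: IH => // t' w r_t'; apply: Pr; rewrite inE r_t' orbT.
elim: k => [|k IHk]; first by rewrite expr0 mul1r.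
by rewrite exprS -mulrA; apply: Pr; rewrite ?inE ?eqxx.
Qed.

(** The sum factors over the generators [t], and the factor of [t] is a geometric
sum in the [m]-th root of unity [t / s t]: it vanishes unless [s] fixes [t]. *)
Lemma sum_monomials_gal (s : gal_of {:L}) (r : seq L) :
    {in r, forall t, unit_radical t} ->
  \sum_(w <- monomials r) w / s w =
    if all (fun t => s t == t) r then (m ^ size r)%:R else 0.
Proof.
elim: r => [_|t r IH rad_r] /=; first by rewrite big_seq1 rmorph1 divr1.
have t0: t != 0 by apply/unit_radical_neq0/rad_r; rewrite inE eqxx.
have IHr := IH (fun t' rt' => rad_r t' (mem_behead (rt' : t' \in behead (t :: r)))).
rewrite big_allpairs_dep /=.
transitivity ((\sum_(k <- iota 0 m) (t / s t) ^+ k) * \sum_(w <- monomials r) w / s w).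
  rewrite mulr_suml; apply: eq_bigr => k _; rewrite mulr_sumr; apply: eq_bigr => w _.
  by rewrite rmorphM rmorphXn /= invfM mulrACA expr_div_n.
rewrite sum_expr_unity ?IHr; last first.
  have [u pu Dt] := rad_r t (mem_head _ _).
  rewrite expr_div_n -rmorphXn Dt rmorph_nat divff //.
  by rewrite -Dt expf_neq0.
have -> : (t / s t == 1) = (s t == t).
  rewrite -(inj_eq (mulIf (x := s t) _)) ?fmorph_eq0 // divfK ?fmorph_eq0 // mul1r.
  exact: eq_sym.
case: eqP => _ /=; last by rewrite mul0r.
by case: ifP => _; rewrite ?mulr0 // expnS natrM.
Qed.

(** Extensions generated by roots of integers prime to [p] are unramified at [p].
Instead of a dual basis, [x] is recovered from the traces of [x / w], where [w]
runs over the monomials in the generators: the sum of the [Tr (x / w) * w] is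
[x] times an integer prime to [p], by [sum_monomials_gal]. If a power of [x] is
divisible by [p], then so is a power of the rational number [Tr (x / w)], hence
that number itself. *)
Lemma Kummer_unramified (th : seq L) (x : L) (n : nat) :
    {in th, forall t, unit_radical t} ->
    ~~ (p %| #|[set s : gal_of {:L} | all (fun t => s t == t) th]|)%N ->
    x \in <<1 & th>>%VS -> emb x \in local_int p_pr -> (0 < n)%N ->
    p%:R^-1 * emb x ^+ n \in local_int p_pr ->
  p%:R^-1 * emb x \in local_int p_pr.
Proof.
move=> rad_th; set H := [set s | _]%SET => pH thx Sx n_gt0 Sxn.
have rad_w : {in monomials th, forall w,
    emb w \in local_int p_pr /\ emb w^-1 \in local_int p_pr}.
  apply: monomials_ind => [|t w /rad_th rad_t [Sw SVw]].
    by rewrite invr1 rmorph1 !rpred1.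
  by split; rewrite ?invfM rmorphM; apply: rpredM => //;
    [exact: unit_radical_local | exact: unit_radical_localV].
have main : (m ^ size th * #|H|)%:R * x =
    \sum_(w <- monomials th) (\sum_(s : gal_of {:L}) s (x / w)) * w.
  under eq_bigr do rewrite mulr_suml.
  rewrite exchange_big /=.
  transitivity (\sum_(s : gal_of {:L}) (if s \in H then (m ^ size th)%:R * x else 0)).
    by rewrite -big_mkcond /= sumr_const natrM mulrAC mulr_natr.
  apply: eq_bigr => s _.
  transitivity (s x * \sum_(w <- monomials th) w / s w).
    rewrite sum_monomials_gal // inE; case: ifP => [/allP fth|_]; last by rewrite mulr0.
    have -> : s x = x by apply: (gal_fixes_adjoin _ thx) => t /fth/eqP.
    exact: mulrC.
  rewrite mulr_sumr; apply: eq_bigr => w _.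
  by rewrite rmorphM fmorphV mulrA mulrAC.
set N := (m ^ size th * #|H|)%N in main.
have pN : ~~ (p %| N)%N by rewrite Euclid_dvdM // Euclid_dvdX // negb_or negb_and pm.
have N0 : N%:R != 0 :> algC.
  by rewrite pnatr_eq0; apply: contraNneq pN => ->; apply: dvdn0.
rewrite -[emb x](mulKf N0) mulrCA rpredM ?local_int_unit //.
rewrite -(rmorph_nat emb N) -rmorphM main rmorph_sum mulr_sumr /= big_seq rpred_sum // => w tw.
have [Sw SVw] := rad_w w tw.
rewrite rmorphM mulrA rpredM //.
have Ssw s : emb (s (x / w)) \in local_int p_pr.
  by rewrite local_int_gal // rmorphM rpredM.
have Sswn s : p%:R^-1 * emb (s (x / w)) ^+ n \in local_int p_pr.
  have <- : emb (s (p%:R^-1 * (x / w) ^+ n)) = p%:R^-1 * emb (s (x / w)) ^+ n.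
    by move: (x / w) => y; rewrite !rmorphM !fmorphV !rmorph_nat !rmorphXn.
  rewrite local_int_gal // rmorphM rmorphXn fmorphV rmorph_nat rmorphM exprMn mulrA.
  by rewrite rpredM // rpredX.
have [k Sk] := @local_int_radical_sum p p_pr _ (index_enum (gal_of {:L})) xpredT _ n
  (fun s _ => Ssw s) (fun s _ => Sswn s) n_gt0.
rewrite rmorph_sum /=; apply: (local_int_rat_radical (n := k)) => //.
  by rewrite -rmorph_sum gal_sum_rat.
by rewrite rpred_sum.
Qed.

End Kummer.
End NumberField.

(** * The totally ramified step *)

Lemma radical_coordinates (F : fieldType) (L : fieldExtType F) (K : {subfield L})
    (d : nat) (r x : L) :
    (0 < d)%N -> r ^+ d \in K -> x \in <<K; r>>%VS ->
  exists2 a : nat -> L, (forall k, a k \in K) & x = \sum_(k < d) a k * r ^+ k.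
Proof.
move=> d_gt0 Krd Krx; pose q := Fadjoin_poly K r x.
have szq : (size q <= d)%N.
  apply: leq_trans (size_Fadjoin_poly _ _ _) _.
  rewrite -ltnS -size_minPoly -(size_XnsubC (r ^+ d) d_gt0) dvdp_leq //.
    by rewrite -size_poly_eq0 size_XnsubC.
  apply: minPoly_dvdp; last by rewrite rootE !hornerE subrr.
  by rewrite rpredB ?rpredX ?polyOverX ?polyOverC.
exists (fun k => q`_k) => [k|]; first exact/polyOverP/Fadjoin_polyOver.
by rewrite -{1}(Fadjoin_poly_eq Krx) (horner_coef_wide _ szq).
Qed.

Section Ramified.
Variables (L : splittingFieldType rat) (emb : {rmorphism L -> algC}).
Variables (p : nat) (p_pr : prime p) (m : nat) (th : seq L) (d : nat) (r : L).
Hypothesis (m_gt0 : (0 < m)%N) (pm : ~~ (p %| m)%N).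
Hypothesis rad_th : {in th, forall t, unit_radical p m t}.
Hypothesis (d_pr : prime d) (ltdp : (d < p)%N).
Hypothesis th_unity : forall z : L, z ^+ d = 1 -> z \in th.
Hypothesis r_root : r ^+ d = p%:R.
Hypothesis L_gen : <<<<1 & th>>; r>>%VS = {:L}%VS.

Local Notation K' := <<1 & th>>%AS.
Local Notation S := (local_int p_pr).

Let d_gt0 : (0 < d)%N := prime_gt0 d_pr.

Lemma prime_ndvd_small n : (0 < n <= d)%N -> ~~ (p %| n)%N.
Proof.
by case/andP=> n_gt0 led; rewrite gtnNdvd // (leq_ltn_trans led).
Qed.

Lemma ramified_root_neq0 : r != 0.
Proof.
apply: contraTneq (prime_natr_neq0 p_pr) => r0; move: r_root.
rewrite r0 expr0n eqn0Ngt d_gt0 /= => /esym/(congr1 emb).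
by rewrite rmorph0 rmorph_nat => ->; rewrite eqxx.
Qed.

Lemma ramified_root_local : emb r \in S.
Proof. by apply: (local_int_root d_gt0); rewrite -rmorphXn r_root rmorph_nat rpred_nat. Qed.

Lemma gal_root_ratio (s : gal_of {:L}) : (s r / r) ^+ d = 1.
Proof.
by rewrite expr_div_n -rmorphXn r_root rmorph_nat divff // -r_root expf_neq0 // ramified_root_neq0.
Qed.

Lemma gal_fixes_base (s : gal_of {:L}) x :
  s \in 'Gal({:L} / K')%g -> x \in <<1 & th>>%VS -> s x = x.
Proof. by move=> sG; apply: fixed_gal sG; apply: subvf. Qed.

Lemma mem_base t : t \in th -> t \in <<1 & th>>%VS.
Proof. exact: seqv_sub_adjoin. Qed.

(** An automorphism that fixes the base is determined by the image of [r], one of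
the at most [d] roots of [X^d - p], and [d < p]. *)
Lemma gal_base_card :
  ~~ (p %| #|[set s : gal_of {:L} | all (fun t => s t == t) th]|)%N.
Proof.
set H := [set s | _]%SET; apply: prime_ndvd_small; apply/andP; split.
  by apply/card_gt0P; exists 1%g; rewrite inE; apply/allP=> t _; rewrite gal_id.
pose rs := [seq (s : gal_of {:L}) r | s <- enum H].
have Urs : uniq rs.
  rewrite map_inj_in_uniq ?enum_uniq // => s t; rewrite !mem_enum !inE => /allP fs /allP ft Est.
  apply/eqP/gal_eqP => x _; have := memvf x; rewrite -L_gen => /Fadjoin_polyP[q Kq ->].
  rewrite -!horner_map /= Est; congr _.[_]; apply/polyP=> i; rewrite !coef_map /=.
  have Kqi := polyOverP Kq i.
  by rewrite !(gal_fixes_adjoin _ Kqi) // => y thy; apply/eqP; [exact: ft | exact: fs].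
have {1}-> : #|H| = size rs by rewrite size_map cardE.
rewrite -ltnS -(size_XnsubC (p%:R : L) d_gt0) max_poly_roots //.
  by rewrite -size_poly_eq0 size_XnsubC.
apply/allP=> _ /mapP[s _ ->].
by rewrite rootE !hornerE -rmorphXn r_root rmorph_nat subrr.
Qed.

(** If [r] were in the base, then [r^d = p] would make [r] divisible by [p], since
the base is unramified at [p]; but the square of [p] does not divide [p]. *)
Lemma ramified_root_notin : r \notin <<1 & th>>%VS.
Proof.
apply/negP=> K'r.
have : p%:R^-1 * emb r \in S.
  apply: (Kummer_unramified (emb := emb) m_gt0 pm rad_th gal_base_card K'r ramified_root_local d_gt0).
  by rewrite -rmorphXn r_root rmorph_nat mulVf ?rpred1 // prime_natr_neq0.
move=> Spr; have : p%:R^-1 \in S.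
  have d2: d = d.-2.+2 by case: d d_pr => [|[|]].
  have := rpredM (rpredX d.-2 ramified_root_local) (rpredM Spr Spr).
  have -> : emb r ^+ d.-2 * (p%:R^-1 * emb r * (p%:R^-1 * emb r)) = p%:R^-1 * (p%:R^-1 * emb r ^+ d).
    by rewrite {2}d2 !exprS; ring.
  by rewrite -rmorphXn r_root rmorph_nat mulVf ?mulr1 // prime_natr_neq0.
rewrite -[_^-1]mulr1 => /(@int_div_local _ p_pr 1).
by rewrite dvdzE /= dvdn1 => /eqP p1; have := prime_gt1 p_pr; rewrite {1}p1.
Qed.

Lemma exists_twist : exists2 s : gal_of {:L}, s \in 'Gal({:L} / K')%g & s r != r.
Proof.
apply/exists_inP; rewrite -negb_forall_in; apply: contra ramified_root_notin => /forall_inP fr.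
have gK' : galois K' {:L} by apply: galoisS (galois_full emb); rewrite sub1v subvf.
rewrite -(galois_fixedField gK'); apply/fixedFieldP; first exact: memvf.
by move=> s /fr/eqP.
Qed.

Section Twist.
Variables (rho : gal_of {:L}) (z : L).
Hypothesis (rhoG : rho \in 'Gal({:L} / K')%g).
Hypothesis (rho_r : rho r = z * r) (z_neq1 : z != 1).

Lemma twist_unity : z ^+ d = 1.
Proof. by have := gal_root_ratio rho; rewrite rho_r mulfK // ramified_root_neq0. Qed.

Lemma twist_prim : d.-primitive_root z.
Proof.
have [k prim_k] := prim_order_exists d_gt0 twist_unity.
case/(primeP d_pr).2/pred2P=> [k1|<- //].
by have := prim_expr_order prim_k; rewrite k1 expr1 => /eqP; rewrite (negPf z_neq1).
Qed.

Lemma twist_neq0 : z != 0.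
Proof. by apply: contraTneq (oner_neq0 L) => z0; rewrite -twist_unity z0 expr0n eqn0Ngt d_gt0 eqxx. Qed.

Lemma twistX_root k : (rho ^+ k)%g r = z ^+ k * r.
Proof.
elim: k => [|k IH]; first by rewrite expr0 mul1r expg0 gal_id.
rewrite expgSr galM ?memvf // IH rmorphM rmorphXn /= rho_r exprSr -mulrA.
by congr (_ ^+ _ * _); apply: gal_fixes_base => //; apply/mem_base/th_unity/twist_unity.
Qed.

Lemma twistX_gal k : (rho ^+ k)%g \in 'Gal({:L} / K')%g.
Proof. exact: groupX. Qed.

(** The coordinate of index [k] is the eigencomponent of [rho] for the eigenvalue
[z^k]; it is extracted by a discrete Fourier transform. *)
Lemma coordinate_trace (a : nat -> L) (k : nat) :
    (forall l, a l \in <<1 & th>>%VS) -> (k < d)%N ->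
  \sum_(j < d) (z ^+ k)^-1 ^+ j * (rho ^+ j)%g (\sum_(l < d) a l * r ^+ l) =
    d%:R * (a k * r ^+ k).
Proof.
move=> K'a ltkd.
transitivity (\sum_(l < d) a l * r ^+ l * \sum_(j <- iota 0 d) (z ^+ l / z ^+ k) ^+ j).
  rewrite -[X in iota 0 X]subn0 -/(index_iota 0 d).
  under [RHS]eq_bigr do rewrite big_mkord mulr_sumr.
  rewrite exchange_big; apply: eq_bigr => j _; rewrite rmorph_sum mulr_sumr.
  apply: eq_bigr => l _; have Eal := gal_fixes_base (twistX_gal j) (K'a l).
  rewrite rmorphM /= Eal rmorphXn /= twistX_root.
  by rewrite exprMn expr_div_n exprVn -!exprM [(j * l)%N]mulnC; ring.
rewrite (bigD1 (Ordinal ltkd)) //= [X in _ + X]big1 => [|l nlk].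
  rewrite addr0 divff ?expf_neq0 ?twist_neq0 //.
  by rewrite sum_expr_unity ?expr1n // eqxx mulrC.
rewrite sum_expr_unity; last first.
  by rewrite expr_div_n [z ^+ l ^+ d]exprAC [z ^+ k ^+ d]exprAC twist_unity !expr1n divr1.
case: eqP => [|_]; last by rewrite mulr0.
have zk0: z ^+ k != 0 by rewrite expf_neq0 ?twist_neq0.
move/(canRL (divfK zk0)); rewrite mul1r => /eqP.
rewrite (eq_prim_root_expr twist_prim) !modn_small // => /eqP lk.
by case/eqP: nlk; apply: val_inj.
Qed.

(** By [coordinate_trace] the term [a k * r^k] is integral at [p], so
[(a k)^d * p^k] is. As [k < d], the power [(p * a k)^d] is divisible by [p], so
that [p * a k] is divisible by [p] because the base is unramified. *)
Lemma coordinate_local (a : nat -> L) (k : nat) :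
    (forall l, a l \in <<1 & th>>%VS) -> (k < d)%N ->
    emb (\sum_(l < d) a l * r ^+ l) \in S -> emb (a k) \in S.
Proof.
move=> K'a ltkd Sx.
have Sz : emb z \in S.
  by apply: (local_int_root d_gt0); rewrite -rmorphXn twist_unity rmorph1 rpred1.
have SzV : emb z^-1 \in S.
  by apply: (local_int_root d_gt0); rewrite -rmorphXn exprVn twist_unity invr1 rmorph1 rpred1.
have pd : ~~ (p %| d)%N by rewrite prime_ndvd_small // d_gt0 /=.
have d0 : d%:R != 0 :> algC by rewrite pnatr_eq0 -lt0n.
have Sark : emb (a k * r ^+ k) \in S.
  rewrite -[emb _](mulKf d0) rpredM ?local_int_unit //.
  rewrite -(rmorph_nat emb d) -rmorphM -coordinate_trace // rmorph_sum rpred_sum // => j _.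
  rewrite rmorphM rpredM ?local_int_gal //.
  by rewrite -exprVn -exprM rmorphXn rpredX.
have Sakd : emb (a k) ^+ d * p%:R ^+ k \in S.
  move/(rpredX d): Sark; rewrite -rmorphXn exprMn exprAC r_root.
  by rewrite rmorphM !rmorphXn rmorph_nat.
pose y := p%:R * a k.
have Syd : p%:R^-1 * emb y ^+ d \in S.
  have Epd : p%:R ^+ d = p%:R * (p%:R ^+ (d - k.+1) * p%:R ^+ k) :> algC.
    by rewrite -exprD -exprS; congr (_ ^+ _); lia.
  have -> : p%:R^-1 * emb y ^+ d = p%:R ^+ (d - k.+1) * (emb (a k) ^+ d * p%:R ^+ k).
    by rewrite /y rmorphM rmorph_nat exprMn Epd -!mulrA mulKf ?prime_natr_neq0 // [_ * p%:R ^+ k]mulrC.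
  by rewrite rpredM // rpredX // rpred_nat.
have Sy : emb y \in S.
  apply: (local_int_root d_gt0); rewrite -[_ ^+ _](mulVKf (prime_natr_neq0 p_pr)).
  by rewrite rpredM // rpred_nat.
have K'y : y \in <<1 & th>>%VS by rewrite rpredM ?rpred_nat.
have := Kummer_unramified (emb := emb) m_gt0 pm rad_th gal_base_card K'y Sy d_gt0 Syd.
by rewrite /y rmorphM rmorph_nat mulKf ?prime_natr_neq0.
Qed.

(** A fixed point of [rho] has no coordinate of positive index, by
[coordinate_trace]. *)
Lemma twist_moves (K : {subfield L}) (x : L) :
    (K <= K')%VS -> x \in <<K; r>>%VS -> x \notin K -> rho x != x.
Proof.
move=> sKK' Krx; apply: contra => /eqP rho_x.
case: (radical_coordinates d_gt0 _ Krx) => [|a Ka Dx]; first by rewrite r_root rpred_nat.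
have K'a l : a l \in <<1 & th>>%VS by apply: subvP sKK' _ (Ka l).
have a0 (k : 'I_d) : (0 < k)%N -> a k = 0.
  move=> k_gt0; have := coordinate_trace K'a (ltn_ord k); rewrite -Dx.
  have rhoX_x j : (rho ^+ j)%g x = x.
    elim: j => [|j IH]; first by rewrite expg0 gal_id.
    by rewrite expgSr galM ?memvf // IH.
  under eq_bigr do rewrite rhoX_x; rewrite -mulr_suml.
  rewrite -(big_mkord xpredT (fun j => (z ^+ k)^-1 ^+ j)) /index_iota subn0.
  rewrite sum_expr_unity; last by rewrite exprVn exprAC twist_unity expr1n invr1.
  rewrite invr_eq1 -(prim_order_dvd twist_prim) gtnNdvd // mul0r => /esym/eqP.
  rewrite !mulf_eq0 expf_eq0 (negPf ramified_root_neq0) andbF orbF.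
  by rewrite -(fmorph_eq0 emb) rmorph_nat pnatr_eq0 eqn0Ngt d_gt0 => /eqP.
rewrite Dx rpred_sum // => k _; have [->|k_gt0] := posnP k.
  by rewrite expr0 mulr1.
by rewrite a0 // mul0r rpred0.
Qed.

End Twist.

Lemma twist_conjugates_uniq (rho : gal_of {:L}) (z : L) (K : {subfield L}) (x : L)
    (i j : nat) :
    rho \in 'Gal({:L} / K')%g -> rho r = z * r -> z != 1 ->
    (K <= K')%VS -> x \in <<K; r>>%VS -> x \notin K -> (i < j < d)%N ->
  (rho ^+ i)%g x != (rho ^+ j)%g x.
Proof.
move=> rhoG rho_r z1 sKK' Krx K'x /andP[ltij ltjd].
have ze1 : z ^+ (j - i) != 1.
  rewrite -(prim_order_dvd (twist_prim rho_r z1)) gtnNdvd ?subn_gt0 //.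
  exact: leq_ltn_trans (leq_subr i j) ltjd.
have := twist_moves (twistX_gal rhoG _) (twistX_root rhoG rho_r _) ze1 sKK' Krx K'x.
apply: contra => /eqP eq_ij; apply/eqP/(fmorph_inj (rho ^+ i)%g).
rewrite /= -galM ?memvf //.
by rewrite -expgD subnK ?(ltnW ltij) // eq_ij.
Qed.

(** In coordinates the constant terms cancel and every other term is a multiple of
[r]. This expresses the total ramification of [p] at [r]. *)
Lemma gal_diff_local (s t : gal_of {:L}) (x : L) :
    s \in 'Gal({:L} / K')%g -> t \in 'Gal({:L} / K')%g ->
  emb x \in S -> emb ((s x - t x) / r) \in S.
Proof.
have [rho rhoG rho_nr] := exists_twist.
have rho_r : rho r = rho r / r * r by rewrite divfK ?ramified_root_neq0.
have z1 : rho r / r != 1 by apply: contra rho_nr => /eqP z1; rewrite rho_r z1 mul1r.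
move=> sG tG; have Lx : x \in <<<<1 & th>>; r>>%VS by rewrite L_gen memvf.
case: (radical_coordinates d_gt0 _ Lx) => [|a K'a Dx]; first by rewrite r_root rpred_nat.
rewrite {1}Dx => /(coordinate_local rhoG rho_r z1 K'a) Sa.
have gal_x (u : gal_of {:L}) : u \in 'Gal({:L} / K')%g ->
    u x = \sum_(k < d) a k * ((u r / r) ^+ k * r ^+ k).
  move=> uG; rewrite Dx rmorph_sum; apply: eq_bigr => k _.
  have Eak := gal_fixes_base uG (K'a k).
  by rewrite rmorphM rmorphXn /= Eak -exprMn divfK ?ramified_root_neq0.
rewrite !gal_x // -sumrB mulr_suml rmorph_sum rpred_sum // => k _.
have Su (u : gal_of {:L}) : emb (u r / r) \in S.
  by apply: (local_int_root d_gt0); rewrite -rmorphXn gal_root_ratio rmorph1 rpred1.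
rewrite -mulrBr -mulrBl -!mulrA rmorphM rpredM ?Sa //.
case: (val k) => [|l]; first by rewrite !expr0 subrr mul0r rmorph0 rpred0.
rewrite [r ^+ l.+1]exprSr mulfK ?ramified_root_neq0 // rmorphM rmorphB !rmorphXn.
by rewrite rpredM ?rpredB ?rpredX ?ramified_root_local ?Su.
Qed.

End Ramified.

(** * Division by a linear factor and primitive polynomials *)

Lemma Aint_lead_root (n : nat) (f : {poly algC}) (a : algC) :
    f \is a polyOver Aint -> (size f <= n.+2)%N -> root f a -> f`_n.+1 * a \in Aint.
Proof.
move=> /polyOverP Af szf fa0; set c := f`_n.+1.
pose h := \poly_(i < n.+1) (f`_i * c ^+ (n - i)).
apply: (@Aint_root_monic ('X^(n.+1) + h)).
- rewrite monicE lead_coefDl ?lead_coefXn // size_polyXn ltnS; exact: size_poly.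
- rewrite rpredD ?rpredX ?polyOverX //; apply: polyOver_poly => i _.
  by rewrite rpredM ?rpredX ?Af.
have fa : c ^+ n * f.[a] = 0 by rewrite (rootP fa0) mulr0.
apply/eqP; rewrite !hornerE horner_poly -[RHS]fa (horner_coef_wide _ szf).
rewrite [X in _ = _ * X]big_ord_recr mulrDr addrC /=; congr (_ + _).
  rewrite mulr_sumr; apply: eq_bigr => i _; have le_in : (i <= n)%N by rewrite -ltnS.
  have -> : c ^+ n = c ^+ (n - i) * c ^+ i by rewrite -exprD subnK.
  by rewrite exprMn; ring.
by rewrite exprMn exprSr -/c; ring.
Qed.

(** A polynomial with integral coefficients keeps this property after exact division
by [X - a], although [a] need not be integral: the leading coefficient times [a] is
integral, so the leading term of the quotient can be split off. *)
Lemma polyOver_Aint_divXsubC (q : {poly algC}) (a : algC) :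
  q * ('X - a%:P) \is a polyOver Aint -> q \is a polyOver Aint.
Proof.
have [n] := ubnP (size q); elim: n q => // n IHn q.
rewrite ltnS => szq Aqa; have [->|q0] := eqVneq q 0; first exact: rpred0.
have [k szqk] : exists k, size q = k.+1.
  by exists (size q).-1; rewrite prednK // lt0n size_poly_eq0.
set f := q * _ in Aqa *.
have szf : size f = k.+2.
  by rewrite size_Mmonic ?monicXsubC // size_XsubC szqk addn2.
have fk : f`_k.+1 = q`_k.
  have := lead_coefM q ('X - a%:P).
  by rewrite lead_coefXsubC mulr1 /lead_coef -/f szf szqk.
have Ac : q`_k \in Aint by rewrite -fk; exact: (polyOverP Aqa).
have Aca : q`_k * a \in Aint.
  by rewrite -fk Aint_lead_root // ?szf // /root hornerM hornerXsubC subrr mulr0.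
have Aq' : (q - q`_k *: 'X^k) \is a polyOver Aint.
  apply: IHn.
    rewrite (leq_trans _ szq) // szqk ltnS; apply/leq_sizeP => j lekj.
    rewrite coefB coefZ coefXn; have [->|njk] := eqVneq j k; first by rewrite mulr1 subrr.
    by rewrite mulr0 subr0 nth_default // szqk ltn_neqAle eq_sym njk.
  rewrite mulrBl -/f rpredB // mulrBr rpredB //.
    by rewrite -scalerAl -exprSr polyOverZ ?rpredX ?polyOverX.
  rewrite -scalerAl mulrC mul_polyC scalerA -mul_polyC rpredM ?rpredX ?polyOverX //.
  by rewrite polyOverC.
by rewrite -[q](subrK (q`_k *: 'X^k)) rpredD // polyOverZ ?rpredX ?polyOverX.
Qed.

(** By Bezout the coefficients of a primitive polynomial generate the unit ideal. *)
Lemma primitive_polyOver (R : nzRingType) (A : zmodClosed R) (f : {poly int}) (x : R) :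
    zcontents f = 1 -> (forall k, x * (f`_k)%:~R \in A) -> x \in A.
Proof.
move=> f1 Axf; rewrite -[x]mulr1.
have AxN (z : int) : x * z%:~R \in A -> x * (`|z|%N)%:R \in A.
  by rewrite {1}[z]intEsg; case: sgzP; rewrite ?mul0r ?mul1r ?mulN1r ?rmorphN ?mulrN ?rpredN // => ->.
have : x * (`|zcontents f|%N)%:R \in A; last by rewrite f1.
rewrite /zcontents abszM.
have -> : `|sgz (lead_coef f)|%N = 1%N.
  have f0 : f != 0 by apply/eqP => f0; rewrite f0 zcontents0 in f1.
  by move: f0; rewrite -lead_coef_eq0; case: sgzP => // ->; rewrite eqxx.
rewrite mul1n /=; apply: (big_ind (fun k : nat => x * k%:R \in A)).
- by rewrite mulr0 rpred0.
- move=> a b Aa Ab; have [u [v Duv]] := Bezoutz a b.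
  have -> : (gcdn a b)%:R = a%:R * u%:~R + b%:R * v%:~R :> R.
    rewrite !pmulrn -!intrM -intrD; congr (_%:~R).
    by rewrite -[LHS]/(gcdz a b) -Duv mulrC [v * _]mulrC.
  by rewrite mulrDr !mulrA !mulrzr rpredD ?rpredMz.
- by move=> k _; apply: AxN.
Qed.

Lemma zcontents_exp1 (f : {poly int}) (k : nat) : zcontents f = 1 -> zcontents (f ^+ k) = 1.
Proof.
move=> f1; elim: k => [|k IH]; first by rewrite expr0 zcontents_monic ?monic1.
by rewrite exprS zcontentsM f1 IH.
Qed.

(** * The conjugate discriminant and its divisibility *)

Section Discriminant.
Variables (L : splittingFieldType rat) (emb : {rmorphism L -> algC}).
Variables (F : {poly int}) (alpha : L) (d : nat) (c : 'I_d -> gal_of {:L}).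
Hypothesis F_prim : zcontents F = 1.
Local Notation C := (lead_coef F).
Local Notation FL := (map_poly (intr : int -> L) F).
Hypothesis F_split : FL = C%:~R *: \prod_(s : gal_of {:L}) ('X - (s alpha)%:P).
Local Notation pairs := [pred q : 'I_d * 'I_d | (q.1 < q.2)%N].

(** The norm to the rationals of the Vandermonde product of the conjugates
[c i alpha], cleared of denominators by a power of the leading coefficient. *)
Definition conjugate_discriminant : L :=
  C%:~R ^+ (2 * #|pairs|) *
  \prod_(s : gal_of {:L}) s (\prod_(q | pairs q) (c q.2 alpha - c q.1 alpha)).

Lemma coef_quotient_Aint (q : {poly L}) :
    FL = q * ('X - alpha%:P) -> map_poly emb q \is a polyOver Aint.
Proof.
move=> /(congr1 (map_poly emb)); rewrite rmorphM /= map_polyXsubC => Dq.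
apply: (@polyOver_Aint_divXsubC _ (emb alpha)); rewrite -Dq.
by apply/polyOverP=> i; rewrite !coef_map /= rmorph_int Aint_int.
Qed.

Local Notation Q_diff q s ij :=
  (map_poly (s : gal_of {:L}) (map_poly (c ij.2) q - map_poly (c ij.1) q)).

(** With [Q_s = F / (X - s alpha)], the difference [Q_t - Q_s] times
[(X - t alpha) * (X - s alpha)] is [F * (t alpha - s alpha)]; the identity is the
product of these relations over all pairs and all automorphisms. *)
Lemma discriminant_identity (q : {poly L}) : FL = q * ('X - alpha%:P) ->
  (\prod_(s : gal_of {:L}) \prod_(ij | pairs ij) Q_diff q s ij) * FL ^+ (2 * #|pairs|) =
  FL ^+ (#|{: gal_of {:L}}| * #|pairs|) * conjugate_discriminant%:P.
Proof.
move=> Dq.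
have gal_FL (s : gal_of {:L}) : map_poly s FL = FL.
  by rewrite -map_poly_comp; apply: eq_map_poly => k; rewrite /= rmorph_int.
have Dqs (s t : gal_of {:L}) :
    map_poly s (map_poly t q) * ('X - (s (t alpha))%:P) = FL.
  transitivity (map_poly s (map_poly t (q * ('X - alpha%:P)))).
    by rewrite !rmorphM /= !map_polyXsubC.
  by rewrite -Dq !gal_FL.
have := F_split; set P := \prod_(s : gal_of {:L}) ('X - (s alpha)%:P) => FP.
have DP (t : gal_of {:L}) : \prod_(s : gal_of {:L}) ('X - (s (t alpha))%:P) = P.
  rewrite [RHS](reindex_inj (mulgI t)); apply: eq_bigr => s _.
  by rewrite galM ?memvf.
have step (s : gal_of {:L}) ij : pairs ij ->
    Q_diff q s ij * (('X - (s (c ij.2 alpha))%:P) * ('X - (s (c ij.1 alpha))%:P)) =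
    FL * (s (c ij.2 alpha - c ij.1 alpha))%:P.
  move=> _; rewrite !rmorphB /= mulrBl {1}mulrA Dqs [X in _ - _ * X]mulrC mulrA Dqs; ring.
rewrite {1}FP exprZn -mul_polyC.
have -> : P ^+ (2 * #|pairs|) =
    \prod_(s : gal_of {:L}) \prod_(ij | pairs ij)
      (('X - (s (c ij.2 alpha))%:P) * ('X - (s (c ij.1 alpha))%:P)).
  rewrite exchange_big /=; under [RHS]eq_bigr do rewrite big_split !DP /=.
  by rewrite prodr_const mul2n -addnn exprD exprMn.
rewrite mulrCA -big_split /=.
under eq_bigr => s _ do rewrite -big_split (eq_bigr _ (step s)) big_split prodr_const /=.
rewrite big_split prodr_const /= -exprM mulrCA mulnC; congr (_ * _).
rewrite /conjugate_discriminant polyCM polyC_exp; congr (_ * _).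
by rewrite rmorph_prod; apply: eq_bigr => s _; rewrite !rmorph_prod.
Qed.

Lemma conjugate_discriminant_rat : emb conjugate_discriminant \in Crat.
Proof. by rewrite rmorphM rpredM ?gal_prod_rat // rmorphXn rmorph_int rpredX ?rpred_int. Qed.

Lemma conjugate_discriminant_neq0 :
  (forall i j : 'I_d, (i < j)%N -> c i alpha != c j alpha) -> conjugate_discriminant != 0.
Proof.
move=> Uc; rewrite mulf_neq0 ?expf_neq0 //.
  rewrite -(fmorph_eq0 emb) rmorph_int intr_eq0 lead_coef_eq0.
  by apply: contra_eq_neq F_prim => ->; rewrite zcontents0.
apply/prodf_neq0 => s _; rewrite fmorph_eq0; apply/prodf_neq0 => -[i j] /= ltij.
by rewrite subr_eq0 eq_sym Uc.
Qed.

(** By [discriminant_identity] the discriminant times a power of [F] has integral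
coefficients, and these are divisible by the product of the images of [r] to the
power [#|pairs|]. Since [F] is primitive, the discriminant has the same two
properties; the product of the images of [r] is a [d]-th root of a power of [p]. *)
Lemma conjugate_discriminant_ge (p : nat) (p_pr : prime p) (r : L) :
    r ^+ d = p%:R ->
    (forall i j : 'I_d, (i < j)%N -> c i alpha != c j alpha) ->
    (forall (i j : 'I_d) (x : L), emb x \in local_int p_pr ->
       emb ((c j x - c i x) / r) \in local_int p_pr) ->
  p%:R ^+ (#|{: gal_of {:L}}| * #|pairs|) <= `|emb conjugate_discriminant| ^+ d.
Proof.
move=> r_root Uc c_diff.
have /factor_theorem[q Dq] : root FL alpha.
  rewrite F_split rootE hornerZ (bigD1 1%g) //= hornerM hornerXsubC gal_id subrr.
  by rewrite mul0r mulr0.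
have Aq := coef_quotient_Aint Dq; set N := emb conjugate_discriminant.
have FE : map_poly emb FL = map_poly (intr : int -> algC) F.
  by rewrite -map_poly_comp; apply: eq_map_poly => k; rewrite /= rmorph_int.
set W := \prod_(s : gal_of {:L}) \prod_(ij | pairs ij) Q_diff q s ij.
set R := \prod_(s : gal_of {:L}) s r.
have E : map_poly emb W * map_poly (intr : int -> algC) (F ^+ (2 * #|pairs|)) =
         map_poly (intr : int -> algC) (F ^+ (#|{: gal_of {:L}}| * #|pairs|)) * N%:P.
  move: (discriminant_identity Dq); rewrite -/W /N; move: W conjugate_discriminant => W D.
  by move/(congr1 (map_poly emb)); rewrite !rmorphM !rmorphXn /= FE map_polyC.
(* The powers of [F] are primitive, so membership is detected on coefficients. *)
have N_in (A : subringClosed algC) (w : algC) :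
    map_poly emb W * w%:P \is a polyOver A -> N * w \in A.
  move=> AWw; apply: (@primitive_polyOver _ _ (F ^+ (#|{: gal_of {:L}}| * #|pairs|))).
    exact: zcontents_exp1.
  move=> k; have := congr1 (fun f => f * w%:P) E.
  rewrite /= mulrAC -[RHS]mulrA -polyCM => /(congr1 (coefp k)); rewrite /=.
  rewrite [in RHS]coefMC coef_map [RHS]mulrC => <-.
  apply/polyOverP; rewrite rpredM //.
  by apply/polyOverP=> j; rewrite coef_map /= rpred_int.
have AN : N \in Aint.
  rewrite -[N]mulr1; apply: (N_in Aint); rewrite mulr1 rmorph_prod rpred_prod // => s _.
  rewrite rmorph_prod rpred_prod // => ij _; apply/polyOverP => k.
  have Aqk (t : gal_of {:L}) : emb (t q`_k) \in Aint.
    by rewrite Aint_gal //; have := polyOverP Aq k; rewrite coef_map.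
  by rewrite !coef_map /= coefB !coef_map /= Aint_gal // rmorphB rpredB // Aqk.
have SN : N / emb R ^+ #|pairs| \in local_int p_pr.
  apply: (N_in (local_int p_pr)).
  have -> : map_poly emb W * (emb R ^+ #|pairs|)^-1%:P = \prod_(s : gal_of {:L})
      \prod_(ij | pairs ij) (map_poly emb (Q_diff q s ij) * (emb (s r))^-1%:P).
    under [RHS]eq_bigr do rewrite big_split prodr_const /=.
    rewrite big_split /= /W rmorph_prod; congr (_ * _).
      by apply: eq_bigr => s _; rewrite rmorph_prod.
    rewrite /R rmorph_prod -exprVn prodrXl -prodfV rmorphXn rmorph_prod /=.
    by [].
  rewrite rpred_prod // => s _; rewrite rpred_prod // => ij _; apply/polyOverP => k.
  rewrite coefMC !coef_map /= coefB !coef_map /= -fmorphV -rmorphM -fmorphV -rmorphM.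
  rewrite local_int_gal // c_diff //.
  by have := polyOverP Aq k; rewrite coef_map; apply: Aint_local.
have DRd : emb R ^+ d = p%:R ^+ #|{: gal_of {:L}}|.
  rewrite -rmorphXn -prodrXl; under eq_bigr do rewrite -rmorphXn r_root rmorph_nat.
  by rewrite prodr_const rmorphXn rmorph_nat.
set e := (#|{: gal_of {:L}}| * #|pairs|)%N.
have Se : N ^+ d / p%:R ^+ e \in local_int p_pr.
  by rewrite /e exprM -DRd exprAC -expr_div_n rpredX.
have := Aint_div_local (rpredX d AN) Se.
move=> Ae; have Ze : N ^+ d / p%:R ^+ e \in Num.int.
  by apply: Cint_rat_Aint => //; rewrite rpredM ?rpredV ?rpredX ?conjugate_discriminant_rat ?rpred_nat.
have p0 : p%:R ^+ e != 0 :> algC by rewrite expf_neq0 // prime_natr_neq0.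
have : 1 <= `|N ^+ d / p%:R ^+ e|.
  apply: norm_intr_ge1 => //; rewrite mulf_neq0 ?invr_eq0 // expf_neq0 //.
  by rewrite fmorph_eq0 conjugate_discriminant_neq0.
rewrite normrM normfV normrX [`|_ ^+ e|]ger0_norm ?exprn_ge0 ?ler0n //.
by rewrite ler_pdivlMr ?mul1r // exprn_gt0 // ltr0n prime_gt0.
Qed.

End Discriminant.

(** * Mahler measure and conjugates *)

Lemma max1_norm (R : numDomainType) (x : R) : (1 <= Num.max 1 `|x|) * (`|x| <= Num.max 1 `|x|).
Proof.
have cmp : (1 >=< `|x|)%O by rewrite real_comparable ?rpred1 ?normr_real.
by split; rewrite comparable_le_max // lexx ?orbT.
Qed.

(** The Leibniz expansion gives [d!] where the inequality of Hadamard gives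
[d^(d/2)]; this only affects the constant of the term [log d / (d - 1)] in the
height bound. *)
Lemma normC_Vandermonde_le (d : nat) (a : 'I_d -> algC) :
  `|\prod_(ij : 'I_d * 'I_d | (ij.1 < ij.2)%N) (a ij.2 - a ij.1)| <=
    (d`!)%:R * \prod_i Num.max 1 `|a i| ^+ d.-1.
Proof.
have -> : \prod_(ij : 'I_d * 'I_d | (ij.1 < ij.2)%N) (a ij.2 - a ij.1) =
    \det (Vandermonde d (\row_i a i)).
  rewrite det_Vandermonde pair_big_dep /=; apply: eq_bigr => ij _.
  by rewrite !mxE.
apply: le_trans (ler_norm_sum _ _ _) _.
apply: (@le_trans _ _ (\sum_(s : 'S_d) \prod_i Num.max 1 `|a i| ^+ d.-1)); last first.
  by rewrite sumr_const card_Sn mulr_natl.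
apply: ler_sum => s _; rewrite normrMsign normr_prod.
rewrite [leRHS](reindex_inj (perm_inj (s := s))) /=.
apply: ler_prod => i _; rewrite normr_ge0 !mxE normrX /=.
apply: (@le_trans _ _ (Num.max 1 `|a (s i)| ^+ i)).
  by apply: lerXn2r; rewrite ?nnegrE ?normr_ge0 ?(le_trans ler01) ?max1_norm.
by rewrite ler_weXn2l ?max1_norm // -ltnS prednK // (leq_ltn_trans _ (ltn_ord i)).
Qed.

Lemma card_lt_pairs (d : nat) :
  (2 * #|[pred ij : 'I_d * 'I_d | (ij.1 < ij.2)%N]| = d * d.-1)%N.
Proof.
have -> : #|[pred ij : 'I_d * 'I_d | (ij.1 < ij.2)%N]| = 'C(d, 2).
  rewrite -bin2_sum big_mkord -sum1_card.
  rewrite -(pair_big_dep xpredT (fun i j : 'I_d => (i < j)%N) (fun _ _ => 1%N)) /=.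
  rewrite (exchange_big_dep xpredT) //=; apply: eq_bigr => j _.
  have le_jd := ltnW (ltn_ord j).
  by rewrite (big_ord_narrow le_jd) /= sum1_card card_ord.
by rewrite bin2 mul2n even_halfK // oddM; case: d => //= d; case: (odd d).
Qed.

Lemma int_minpolyE (a : algC) :
  [/\ map_poly intr (int_minpoly a) = (lead_coef (int_minpoly a))%:~R *: minCpoly a,
      zcontents (int_minpoly a) = 1 & 0 < lead_coef (int_minpoly a)].
Proof.
rewrite /int_minpoly; case: (minCpolyP a) => q /= [Dq mon_q] _.
case: (rat_poly_scale q) => g /= [c c0 Dg].
have g0 : g != 0.
  by apply: contraTneq (monic_neq0 mon_q) => g0; rewrite Dg g0 rmorph0 scaler0 eqxx.
split; last 2 first.
- by rewrite zcontents_primitive g0.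
- by rewrite -sgz_gt0 sgz_lead_primitive g0.
set h := zprimitive g.
have Dh : map_poly (intr : int -> rat) g = (zcontents g)%:~R *: map_poly intr h.
  by rewrite {1}[g]zpolyEprim map_polyZ.
have Eq : q = (c%:~R^-1 * (zcontents g)%:~R) *: map_poly intr h by rewrite Dg Dh scalerA.
have : lead_coef q = 1 by apply/monicP.
rewrite {1}Eq lead_coefZ lead_coef_map_inj //; last exact: intr_inj.
move=> E1; rewrite Dq.
have <- : map_poly (ratr : rat -> algC) (map_poly intr h) = map_poly intr h.
  by rewrite -map_poly_comp; apply: eq_map_poly => z /=; rewrite rmorph_int.
rewrite Eq map_polyZ scalerA -(rmorph_int (ratr : rat -> algC)) -rmorphM mulrC E1.
by rewrite rmorph1 scale1r.
Qed.

Lemma minCpoly_conjugates (a : algC) : minCpoly a = \prod_(b <- conjugates a) ('X - b%:P).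
Proof.
rewrite /conjugates; case: closed_field_poly_normal => s /= {1}->.
by rewrite (monicP (minCpoly_monic a)) scale1r.
Qed.

Lemma size_conjugates (a : algC) : size (conjugates a) = algdeg a.
Proof. by rewrite /algdeg minCpoly_conjugates size_prod_XsubC. Qed.

Section Orbit.
Variables (L : splittingFieldType rat) (emb : {rmorphism L -> algC}) (alpha : L).

Definition stabilizer_order := #|[set s : gal_of {:L} | s alpha == alpha]|.

Let orbit := undup [seq s alpha | s : gal_of {:L}].

(** The fibres of [s |-> s alpha] are the cosets of the stabilizer of [alpha]. *)
Lemma prod_orbit (R : comNzRingType) (f : L -> R) :
  \prod_(s : gal_of {:L}) f (s alpha) = (\prod_(b <- orbit) f b) ^+ stabilizer_order.
Proof.
transitivity (\prod_(b <- [seq s alpha | s : gal_of {:L}]) f b).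
  by rewrite big_image /=; apply: eq_bigl.
rewrite -prodr_undup_exp_count -/orbit -prodrXl.
apply: eq_big_seq => b; rewrite mem_undup => /mapP[t _ ->]; congr (_ ^+ _).
rewrite /image_mem count_map /stabilizer_order.
rewrite -[RHS](card_imset _ (mulIg t)) [RHS]cardE {2}/enum_mem size_filter.
rewrite enumT; apply: eq_count => s /=; apply/eqP/imsetP => [st|[u]].
  exists (s * t^-1)%g; last by rewrite mulgKV.
  by rewrite inE galM ?memvf // st -galM ?memvf // mulgV gal_id.
by rewrite inE => /eqP u_alpha ->; rewrite galM ?memvf // u_alpha.
Qed.

(** The product over the orbit has rational coefficients, as it is stable under the
Galois group, and its roots are distinct conjugates of [alpha]. *)
Lemma minCpoly_orbit :
  minCpoly (emb alpha) = \prod_(b <- orbit) ('X - (emb b)%:P).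
Proof.
have orbitP (s : gal_of {:L}) : s alpha \in orbit.
  by rewrite mem_undup; apply/mapP; exists s; rewrite ?mem_enum.
have orbit_stable (s : gal_of {:L}) : perm_eq (map s orbit) orbit.
  apply: uniq_perm; rewrite ?map_inj_uniq ?undup_uniq //; first exact: fmorph_inj.
  have /uniq_min_size : {subset map s orbit <= orbit}.
    move=> _ /mapP[b + ->]; rewrite mem_undup => /mapP[t _ ->].
    by rewrite -galM ?memvf // orbitP.
  by case=> //; rewrite ?size_map // map_inj_uniq ?undup_uniq //; apply: fmorph_inj.
pose Q := \prod_(b <- orbit) ('X - b%:P).
have Q_rat k : emb Q`_k \in Crat.
  apply: fixed_rat => s; rewrite -coef_map rmorph_prod; congr (_ : {poly _})`_k.
  rewrite -[RHS](perm_big _ (orbit_stable s)) big_map.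
  by apply: eq_bigr => b _; rewrite /= map_polyXsubC.
have EQ : map_poly emb Q = \prod_(b <- orbit) ('X - (emb b)%:P).
  by rewrite rmorph_prod; apply: eq_bigr => b _; rewrite /= map_polyXsubC.
pose q := \poly_(i < size Q) getCrat (emb Q`_i).
have Dq : map_poly ratr q = map_poly emb Q.
  apply/polyP=> i; rewrite !coef_map coef_poly; case: ltnP => [_|le_i] /=.
    by rewrite getCratK.
  by rewrite nth_default // !rmorph0.
rewrite -EQ; apply/eqP; rewrite -eqp_monic ?minCpoly_monic //; last first.
  by rewrite EQ monic_prod_XsubC.
apply/andP; split.
  have [q0 [-> _] dv_q0] := minCpolyP (emb alpha).
  rewrite -Dq dvdp_map -dv_q0 Dq fmorph_root root_prod_XsubC.
  by rewrite -{1}(gal_id {:L} alpha) orbitP.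
rewrite EQ -(big_map emb xpredT (fun b => 'X - b%:P)) uniq_roots_dvdp //.
  apply/allP=> _ /mapP[b + ->]; rewrite mem_undup => /mapP[s _ ->].
  have [nu nuP] := extend_algC_subfield_aut emb s.
  by rewrite nuP -(minCpoly_aut nu) root_minCpoly.
by rewrite uniq_rootsE map_inj_uniq ?undup_uniq //; apply: fmorph_inj.
Qed.

Lemma conjugates_orbit : perm_eq (conjugates (emb alpha)) (map emb orbit).
Proof.
by apply: prod_XsubC_eq; rewrite -minCpoly_conjugates big_map minCpoly_orbit.
Qed.

Lemma prod_gal_conjugates (R : comNzRingType) (f : algC -> R) :
  \prod_(s : gal_of {:L}) f (emb (s alpha)) =
    (\prod_(b <- conjugates (emb alpha)) f b) ^+ stabilizer_order.
Proof.
by rewrite (prod_orbit (f \o emb)) (perm_big _ conjugates_orbit) big_map.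
Qed.

Lemma card_gal_stabilizer :
  #|{: gal_of {:L}}| = (algdeg (emb alpha) * stabilizer_order)%N.
Proof.
have := congr1 (fun p : {poly int} => (size p).-1) (prod_gal_conjugates (fun _ => 'X)).
rewrite prodr_const big_const_seq count_predT iter_mulr_1 -exprM !size_polyXn /=.
by rewrite size_conjugates.
Qed.

Lemma int_minpoly_splits :
  map_poly (intr : int -> L) (int_minpoly (emb alpha) ^+ stabilizer_order) =
  (lead_coef (int_minpoly (emb alpha) ^+ stabilizer_order))%:~R *:
    \prod_(s : gal_of {:L}) ('X - (s alpha)%:P).
Proof.
have [Dg _ _] := int_minpolyE (emb alpha).
apply: (map_poly_inj emb); rewrite map_polyZ /= rmorph_int rmorph_prod /=.
rewrite -map_poly_comp (eq_map_poly (g := intr)) => [|k]; last by rewrite /= rmorph_int.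
under eq_bigr do rewrite map_polyXsubC.
rewrite (prod_gal_conjugates (fun b => 'X - b%:P)) -minCpoly_conjugates.
by rewrite rmorphXn /= Dg exprZn lead_coef_exp rmorphXn.
Qed.

Lemma mahler_gal :
  mahler (emb alpha) ^+ stabilizer_order =
  (lead_coef (int_minpoly (emb alpha) ^+ stabilizer_order))%:~R *
    \prod_(s : gal_of {:L}) Num.max 1 `|emb (s alpha)|.
Proof.
by rewrite (prod_gal_conjugates (fun b => Num.max 1 `|b|)) exprMn lead_coef_exp rmorphXn.
Qed.

(** The determinant bound is applied under each automorphism [s]. Multiplied over
all [s], the factors [Num.max 1] form a power of the Mahler measure, and the
leading coefficients that complete it are those in the definition of the
discriminant. *)
Lemma conjugate_discriminant_le (d : nat) (c : 'I_d -> gal_of {:L}) :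
  `|emb (conjugate_discriminant (int_minpoly (emb alpha) ^+ stabilizer_order) alpha c)| <=
  (d`!)%:R ^+ #|{: gal_of {:L}}| * mahler (emb alpha) ^+ (stabilizer_order * (d * d.-1)).
Proof.
rewrite exprM mahler_gal /conjugate_discriminant card_lt_pairs.
set C := lead_coef _; have [_ _ g_gt0] := int_minpolyE (emb alpha).
have C_ge0 : 0 <= C%:~R :> algC by rewrite ler0z /C lead_coef_exp exprn_ge0 // ltW.
rewrite rmorphM rmorphXn rmorph_int normrM normrX ger0_norm // exprMn mulrCA.
apply: ler_wpM2l; first exact: exprn_ge0.
set m := fun x : algC => Num.max 1 `|x|.
rewrite rmorph_prod normr_prod /=.
have -> : (d`!)%:R ^+ #|{: gal_of {:L}}| * (\prod_(s : gal_of {:L}) m (emb (s alpha))) ^+ (d * d.-1) =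
    \prod_(s : gal_of {:L}) ((d`!)%:R * \prod_i m (emb (s (c i alpha))) ^+ d.-1).
  rewrite big_split prodr_const /=; congr (_ * _); rewrite exchange_big /=.
  rewrite [(d * d.-1)%N]mulnC exprM -[X in _ ^+ X = _](card_ord d) -prodr_const; apply: eq_bigr => i _.
  rewrite prodrXl; congr (_ ^+ _); rewrite [LHS](reindex_inj (mulgI (c i))).
  by apply: eq_bigr => s _; rewrite galM ?memvf.
apply: ler_prod => s _; rewrite normr_ge0 /=.
apply: le_trans (normC_Vandermonde_le (fun i => emb (s (c i alpha)))).
rewrite !rmorph_prod /=; under eq_bigr do rewrite !rmorphB /=.
exact: lexx.
Qed.

End Orbit.

Local Open Scope classical_set_scope.
Local Open Scope ring_scope.

(** * The fields generated by radicals *)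

Lemma splitting_number_field (P : {poly rat}) (s : seq algC) :
    map_poly ratr P = \prod_(b <- s) ('X - b%:P) ->
  exists (L : splittingFieldType rat) (emb : {rmorphism L -> algC}) (s1 : seq L),
    map emb s1 = s /\ <<1 & s1>>%VS = {:L}%VS.
Proof.
move=> DP; have [L0 [emb [s1 Ds1 gen_s1]]] := num_field_exists s.
have splL : SplittingField.axiom L0.
  exists (map_poly (in_alg L0) P).
    by apply/polyOverP=> i; rewrite coef_map /= rpredZ ?rpred1.
  exists s1 => //; congr (_ %= _): (eqpxx (map_poly (in_alg L0) P)).
  apply: (map_poly_inj emb); rewrite -map_poly_comp rmorph_prod /=.
  rewrite (eq_map_poly (g := ratr)) => [|a]; last by rewrite /= rmorphZ_num rmorph1 mulr1.
  by rewrite DP -Ds1 big_map; apply: eq_bigr => b _; rewrite map_polyXsubC.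
pose L : splittingFieldType rat := HB.pack L0 (FieldExt_isSplittingField.Build rat L0 splL).
by exists L, emb, s1.
Qed.

(** By induction on the generators: an element is a polynomial expression in the
last one over the field generated by the previous ones. *)
Lemma adjoin_divring_closed (L : fieldExtType rat) (emb : {rmorphism L -> algC})
    (K : divringClosed algC) (ts : seq L) (y : L) :
  {in ts, forall t, emb t \in K} -> y \in <<1 & ts>>%VS -> emb y \in K.
Proof.
elim/last_ind: ts y => [|ts t IH] y Kts.
  rewrite Fadjoin_nil => /vlineP[a ->].
  rewrite rmorphZ_num rmorph1 mulr1 /ratr.
  exact: rpred_div (rpred_int K (numq a)) (rpred_int K (denq a)).
rewrite adjoin_rcons => /Fadjoin_polyP[q /polyOverP Kq ->].
rewrite -horner_map; apply: rpred_horner; last by apply: Kts; rewrite mem_rcons inE eqxx.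
apply/polyOverP=> i; rewrite coef_map; apply: IH => // u tsu.
by apply: Kts; rewrite mem_rcons inE tsu orbT.
Qed.

Lemma mem_generated_field (A : set algC) (x : algC) (L : fieldExtType rat)
    (emb : {rmorphism L -> algC}) (ts : seq L) :
    A = [set emb t | t in [set` ts]] ->
  generated_field A x <-> exists2 y, y \in <<1 & ts>>%VS & x = emb y.
Proof.
move=> DA; split=> [gen_x | [y + ->{x}] K Kdiv AK].
  pose K : {pred algC} := fun x => `[< exists2 y, y \in <<1 & ts>>%VS & x = emb y >].
  suff /asboolP : x \in K by [].
  apply: gen_x => [|a]; last first.
    rewrite DA => -[t /= tst <-]; apply/asboolP; exists t => //.
    exact: seqv_sub_adjoin.
  split=> [|a b /asboolP[y ty ->] /asboolP[z tz ->]|a b /asboolP[y ty ->] /asboolP[z tz ->]];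
    apply/asboolP.
  - by exists 1; rewrite ?rpred1 ?rmorph1.
  - by exists (y - z); rewrite ?rpredB ?rmorphB.
  - by exists (y / z); rewrite ?rpredM ?rpredV ?fmorph_div.
pose KK : divringClosed algC := HB.pack K (GRing.isDivringClosed.Build algC K Kdiv).
apply: (@adjoin_divring_closed _ emb KK) => t tst.
by apply: AK; rewrite DA; exists t.
Qed.

Definition radical_field (r : nat -> algC) (n : nat) : set algC :=
  generated_field [set r j | j in [set j | (j < n)%N]].

Lemma mahler_ge1 (a : algC) : 1 <= mahler a.
Proof.
have [_ _ g_gt0] := int_minpolyE a; rewrite /mahler.
have c1 : 1 <= (lead_coef (int_minpoly a))%:~R :> algC by rewrite ler1z.
apply: mulr_ege1 => //; elim/big_ind: _ => //; first exact: mulr_ege1.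
by move=> b _; rewrite max1_norm.
Qed.

Lemma range_map_iota (T : eqType) (emb : T -> algC) (ts : seq T) (r : nat -> algC) (n : nat) :
  map emb ts = [seq r j | j <- iota 0 n] ->
  [set r j | j in [set j | (j < n)%N]] = [set emb t | t in [set` ts]].
Proof.
move=> Dts; apply/seteqP; split=> [_ [j /= ltjn <-]|_ [t /= tst <-]].
  have : r j \in map emb ts by rewrite Dts map_f // mem_iota.
  by case/mapP=> t tst ->; exists t.
have : emb t \in map emb ts by apply: map_f.
by rewrite Dts => /mapP[j]; rewrite mem_iota => /= ltjn ->; exists j.
Qed.

Section RadicalStep.
Variables (d p : nat -> nat) (r : nat -> algC) (i : nat).
Hypothesis (d_prime : forall j, prime (d j)) (p_prime : forall j, prime (p j)).
Hypothesis r_root : forall j, r j ^+ d j = (p j)%:R.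
Hypothesis d_lt : forall j, (j <= i)%N -> (d j < p i)%N.
Hypothesis p_neq : forall j, (j < i)%N -> p j != p i.

Let m := (\prod_(j < i.+1) d j)%N.

Let base_poly : {poly rat} := ('X^m - 1) * \prod_(j < i) ('X^(d j) - (p j)%:R%:P).
Let top_poly : {poly rat} := 'X^(d i) - (p i)%:R%:P.

Lemma dvdn_radical_order j : (j <= i)%N -> (d j %| m)%N.
Proof.
by move=> le_ji; rewrite /m (bigD1 (Ordinal (le_ji : (j < i.+1)%N))) //= dvdn_mulr.
Qed.

Lemma radical_order_gt0 : (0 < m)%N.
Proof. by rewrite prodn_gt0 // => j; rewrite prime_gt0. Qed.

Lemma radical_order_coprime : ~~ (p i %| m)%N.
Proof.
rewrite /m; elim/big_ind: _ => [|x y px py|j _].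
- by rewrite dvdn1 neq_ltn prime_gt1 ?orbT.
- by rewrite Euclid_dvdM // negb_or px.
- by rewrite gtnNdvd ?prime_gt0 // d_lt // -ltnS.
Qed.

(** The ambient Galois field is generated by all the roots of [X^m - 1], of the
[X^(d j) - p j] with [j < i] and of [X^(d i) - p i]; [th] lists those of the first
two kinds, which are radicals of integers prime to [p i], and [w] represents [r i]. *)
Lemma radical_tower_exists :
  exists (L : splittingFieldType rat) (emb : {rmorphism L -> algC}) (th ts : seq L) (w : L),
  [/\ [/\ {in th, forall t, unit_radical (p i) m t},
      (forall z : L, z ^+ d i = 1 -> z \in th) & w ^+ d i = (p i)%:R],
      <<<<1 & th>>; w>>%VS = {:L}%VS, {subset ts <= th} &
      map emb ts = [seq r j | j <- iota 0 i] /\ emb w = r i].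
Proof.
have [rs0 Drs0] := closed_field_poly_normal (map_poly (ratr : rat -> algC) base_poly).
have [rs1 Drs1] := closed_field_poly_normal (map_poly (ratr : rat -> algC) top_poly).
have mon_top : top_poly \is monic by apply: monicXnsubC; rewrite prime_gt0.
have mon_base : base_poly \is monic.
  rewrite monicMl ?monicXnsubC ?radical_order_gt0 //.
  by apply: monic_prod => j _; apply: monicXnsubC; rewrite prime_gt0.
rewrite lead_coef_map (monicP mon_base) rmorph1 scale1r in Drs0.
rewrite lead_coef_map (monicP mon_top) rmorph1 scale1r in Drs1.
have [] := @splitting_number_field (base_poly * top_poly) (rs0 ++ rs1).
  by rewrite rmorphM /= Drs0 Drs1 big_cat.
move=> L [emb [s1 [Ds1 gen_s1]]].
pose th := take (size rs0) s1.
have Dth : map emb th = rs0 by rewrite /th map_take Ds1 take_size_cat.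
have thP t : (t \in th) = root (map_poly (ratr : rat -> algC) base_poly) (emb t).
  by rewrite Drs0 root_prod_XsubC -Dth mem_map //; apply: fmorph_inj.
have root_base t : root (map_poly (ratr : rat -> algC) base_poly) t =
    (t ^+ m == 1) || [exists j : 'I_i, t ^+ d j == (p j)%:R].
  rewrite /base_poly rmorphM rmorphB rmorph1 rmorph_prod /= map_polyXn rootE hornerM mulf_eq0.
  rewrite !hornerE subr_eq0; congr (_ || _).
  rewrite horner_prod; apply/prodf_eq0/existsP => -[j].
    move=> _ tj; exists j.
    by move: tj; rewrite rmorphB /= map_polyXn map_polyC /= rmorph_nat !hornerE subr_eq0.
  move=> tj; exists j => //.
  by rewrite rmorphB /= map_polyXn map_polyC /= rmorph_nat !hornerE subr_eq0.
have root_top t : (t \in rs1) = (t ^+ d i == (p i)%:R).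
  rewrite -root_prod_XsubC -Drs1 /top_poly rmorphB /= map_polyXn map_polyC /= rmorph_nat.
  by rewrite rootE !hornerE subr_eq0.
have in_th t : (t \in th) = (emb t ^+ m == 1) || [exists j : 'I_i, emb t ^+ d j == (p j)%:R].
  by rewrite thP root_base.
have th_unity (z : L) : z ^+ d i = 1 -> z \in th.
  move=> z1; rewrite in_th -rmorphXn; have /dvdnP[k ->] := dvdn_radical_order (leqnn i).
  by rewrite mulnC exprM z1 expr1n rmorph1 eqxx.
have [w s1w Dw] : exists2 w, w \in s1 & emb w = r i.
  have : r i \in map emb s1 by rewrite Ds1 mem_cat root_top r_root eqxx orbT.
  by case/mapP=> w s1w ->; exists w.
have [ts sub_ts Dts] : exists2 ts, {subset ts <= th} & map emb ts = [seq r j | j <- iota 0 i].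
  have : {subset [seq r j | j <- iota 0 i] <= map emb th}.
    move=> x /mapP[j]; rewrite mem_iota add0n => /= ltji ->.
    rewrite Dth -root_prod_XsubC -Drs0 root_base; apply/orP; right.
    by apply/existsP; exists (Ordinal ltji); rewrite /= r_root.
  elim: [seq r j | j <- iota 0 i] => [|x s IHs] sub_s; first by exists [::].
  have [|ts sub_ts Dts] := IHs; first by move=> y sy; rewrite sub_s // inE sy orbT.
  have /mapP[t tht Dt] := sub_s x (mem_head _ _).
  exists (t :: ts); last by rewrite /= Dts Dt.
  by move=> u; rewrite inE => /predU1P[->|/sub_ts].
have w_root : w ^+ d i = (p i)%:R.
  by apply: (fmorph_inj emb); rewrite rmorphXn Dw r_root rmorph_nat.
have w0 : w != 0.
  apply/eqP=> w00; move: w_root; rewrite w00 expr0n eqn0Ngt prime_gt0 //= => /esym/eqP.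
  by rewrite -(fmorph_eq0 emb) rmorph_nat pnatr_eq0 eqn0Ngt prime_gt0.
exists L, emb, th, ts, w; split=> //; first split=> //.
  move=> t; rewrite in_th => /orP[/eqP t1|/existsP[j /eqP tj]].
    exists 1%N; first by rewrite dvdn1 neq_ltn prime_gt1 ?orbT.
    by apply: (fmorph_inj emb); rewrite rmorphXn t1 rmorph1.
  have /dvdnP[k Dk] := dvdn_radical_order (ltnW (ltn_ord j)).
  exists (p j ^ k)%N.
    rewrite Euclid_dvdX // negb_and dvdn_prime2 // eq_sym p_neq //.
  by apply: (fmorph_inj emb); rewrite rmorphXn Dk mulnC exprM tj -natrX rmorph_nat.
apply/eqP; rewrite eqEsubv subvf -gen_s1 /=; apply/Fadjoin_seqP; split; first exact: sub1v.
move=> t s1t.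
have : emb t \in rs0 ++ rs1 by rewrite -Ds1 map_f.
rewrite mem_cat -Dth mem_map; last exact: fmorph_inj.
case/orP=> [tht|]; first by apply: subvP_adjoin; apply: seqv_sub_adjoin.
rewrite root_top => /eqP td.
have tw : t / w \in th.
  apply: th_unity; apply: (fmorph_inj emb).
  by rewrite expr_div_n w_root fmorph_div rmorphXn td rmorph_nat rmorph1 divff // pnatr_eq0 -lt0n prime_gt0.
rewrite -(divfK w0 t) rpredM ?memv_adjoin //.
by apply: subvP_adjoin; apply: seqv_sub_adjoin.
Qed.

(** The radical [r i] is not even in the larger field generated by [th]. *)
Lemma radical_notin : ~ radical_field r i (r i).
Proof.
have [L [emb [th [ts [w [[rad_th th_unity w_root] L_gen sub_ts [Dts Dw]]]]]]] :=
  radical_tower_exists.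
case/(mem_generated_field _ (range_map_iota Dts)) => y Ky; rewrite -Dw => /fmorph_inj Dy.
have /negP[] := ramified_root_notin emb (p_prime i) radical_order_gt0 radical_order_coprime rad_th
  (d_prime i) (d_lt (leqnn i)) w_root L_gen.
rewrite Dy; apply: subvP Ky; apply/Fadjoin_seqP; split; first exact: sub1v.
by move=> t /sub_ts; apply: seqv_sub_adjoin.
Qed.

(** The upper and lower bounds for the conjugate discriminant are raised to the
square, which replaces the number of pairs by [d * d.-1]; then the common
exponent [k * d] is removed, where [k] is the order of the stabilizer of
[alpha] and the Galois group has order [algdeg alpha * k]. *)
Theorem radical_step (alpha : algC) :
    radical_field r i.+1 alpha -> ~ radical_field r i alpha ->
  (d i <= algdeg alpha)%N /\
  (p i)%:R ^+ (algdeg alpha * (d i).-1) <=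
    (((d i)`!)%:R ^+ algdeg alpha * mahler alpha ^+ (d i * (d i).-1)) ^+ 2.
Proof.
move=> Fa nFa.
have [L [emb [th [ts [w [[rad_th th_unity w_root] L_gen sub_ts [Dts Dw]]]]]]] :=
  radical_tower_exists.
have range_ts := range_map_iota Dts.
have range_ts1 : [set r j | j in [set j | (j < i.+1)%N]] = [set emb t | t in [set` rcons ts w]].
  by apply: range_map_iota; rewrite map_rcons Dts Dw -addn1 iotaD map_cat cats1.
have [a La Da] := (mem_generated_field alpha range_ts1).1 Fa.
rewrite adjoin_rcons in La.
have nKa : a \notin <<1 & ts>>%VS.
  by apply/negP => Ka; apply: nFa; apply/(mem_generated_field _ range_ts); exists a.
have sub_K : (<<1 & ts>> <= <<1 & th>>)%VS.
  apply/Fadjoin_seqP; split; first exact: sub1v.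
  by move=> t /sub_ts; apply: seqv_sub_adjoin.
have ltdp := d_lt (leqnn i); set D := d i in ltdp *; set P := p i in ltdp *.
have D_pr : prime D := d_prime i.
have P_pr : prime P := p_prime i.
have [rho rhoG rho_w] := exists_twist emb P_pr radical_order_gt0 radical_order_coprime
  rad_th D_pr ltdp w_root L_gen.
have w0 : w != 0 := ramified_root_neq0 emb P_pr D_pr w_root.
have rho_z : rho w = rho w / w * w by rewrite divfK.
have z1 : rho w / w != 1 by apply: contra rho_w => /eqP z1; rewrite rho_z z1 mul1r.
pose c (j : 'I_D) := (rho ^+ j)%g.
have Uc (j k : 'I_D) : (j < k)%N -> c j a != c k a.
  move=> ltjk; apply: (twist_conjugates_uniq emb P_pr D_pr th_unity w_root rhoG rho_z z1 sub_K La nKa).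
  by rewrite ltjk ltn_ord.
set n := algdeg alpha; have n_eq := card_gal_stabilizer emb a; rewrite -Da -/n in n_eq.
split.
  have -> : D = size [seq emb (c j a) | j : 'I_D] by rewrite size_map size_enum_ord.
  rewrite /n -size_conjugates; apply: uniq_leq_size => [|_ /mapP[j _ ->]].
    rewrite map_inj_uniq ?enum_uniq // => j l /fmorph_inj; have [ltjl|ltlj|/val_inj//] := ltngtP j l.
      by move/eqP; rewrite (negPf (Uc _ _ ltjl)).
    by move/esym/eqP; rewrite (negPf (Uc _ _ ltlj)).
  rewrite Da (perm_mem (conjugates_orbit emb a)) map_f // mem_undup.
  by apply/mapP; exists (c j); rewrite ?mem_enum.
set k := stabilizer_order a in n_eq.
have F_prim : zcontents (int_minpoly alpha ^+ k) = 1.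
  by have [_ g1 _] := int_minpolyE alpha; apply: zcontents_exp1.
have F_split := int_minpoly_splits emb a; rewrite -Da -/k in F_split.
have le_disc := conjugate_discriminant_le emb a c; rewrite -Da -/k in le_disc.
have ge_disc := conjugate_discriminant_ge (emb := emb) F_prim F_split (p_pr := P_pr) w_root Uc.
pose B := #|[pred ij : 'I_D * 'I_D | (ij.1 < ij.2)%N]|.
have DB : (2 * B = D * D.-1)%N := card_lt_pairs D.
have {}ge_disc : P%:R ^+ (n * k * B) <=
    ((D`!)%:R ^+ (n * k) * mahler alpha ^+ (k * (D * D.-1))) ^+ D.
  rewrite n_eq in ge_disc le_disc; apply: le_trans (ge_disc _) _ => [j l x|].
    exact: (gal_diff_local radical_order_gt0 radical_order_coprime
    rad_th D_pr ltdp th_unity w_root L_gen (twistX_gal rhoG _) (twistX_gal rhoG _)).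
  apply: lerXn2r le_disc; first exact: normr_ge0.
  by rewrite nnegrE mulr_ge0 ?exprn_ge0 ?ler0n // (le_trans ler01 (mahler_ge1 _)).
have k_gt0 : (0 < k)%N.
  by apply/card_gt0P; exists 1%g; rewrite inE gal_id.
set X := _ * mahler alpha ^+ (D * _).
have X_ge0 : 0 <= X.
  by rewrite mulr_ge0 ?exprn_ge0 ?ler0n // (le_trans ler01 (mahler_ge1 _)).
have DX : (D`!)%:R ^+ (n * k) * mahler alpha ^+ (k * (D * D.-1)) = X ^+ k.
  by rewrite /X [RHS]exprMn -!exprM [(k * _)%N]mulnC.
rewrite {}DX -exprM in ge_disc.
have kD_gt0 : (0 < k * D)%N by rewrite muln_gt0 k_gt0 prime_gt0.
have EP : (P%:R ^+ (n * D.-1)) ^+ (k * D) = (P%:R ^+ (n * k * B)) ^+ 2 :> algC.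
  by rewrite -!exprM; congr (_ ^+ _); rewrite -[RHS]mulnA [(B * 2)%N]mulnC DB; lia.
rewrite -(ler_pXn2r kD_gt0) ?nnegrE ?exprn_ge0 ?ler0n // EP [X in _ <= X]exprAC.
by rewrite lerXn2r ?nnegrE ?exprn_ge0 ?ler0n.
Qed.

End RadicalStep.

(** * Lower bounds for heights *)

Section Embedding.
Variable R : realType.
Local Notation toR := (@algC_to_real R).

Lemma algC_to_real_has_sup (x : algC) : 0 <= x ->
  has_sup [set (ratr q : R) | q in [set q : rat | (ratr q : algC) <= x]].
Proof.
move=> x_ge0; split; first by exists (ratr 0) => //; exists 0 => //=; rewrite rmorph0.
have [k lt_xk] : exists k : nat, x < k%:R.
  exists (Num.bound x); have := archi_boundP x_ge0; by [].
exists (k%:R) => _ [q /= le_qx <-].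
rewrite -(ratr_nat R k) ler_rat; have := le_lt_trans le_qx lt_xk.
by rewrite -(ratr_nat algC k) ltr_rat => /ltW.
Qed.

Lemma ratr_le_algC_to_real (x : algC) (q : rat) :
  0 <= x -> ratr q <= x -> ratr q <= toR x.
Proof.
move=> x0 le_qx; apply: ub_le_sup; first by case: (algC_to_real_has_sup x0).
by exists q.
Qed.

Lemma algC_to_real_le_ratr (x : algC) (q : rat) : 0 <= x -> x <= ratr q -> toR x <= ratr q.
Proof.
move=> x0 le_xq; apply: ge_sup; first by case: (algC_to_real_has_sup x0).
by move=> _ [q' /= le_q'x <-]; rewrite ler_rat; have := le_trans le_q'x le_xq; rewrite ler_rat.
Qed.

Lemma le_ratr_of_algC_to_real_lt (x : algC) (q : rat) :
  0 <= x -> toR x < ratr q -> x <= ratr q.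
Proof.
move=> x0 lt_xq; rewrite real_leNgt; [|exact: ger0_real|exact/Creal_Crat/Crat_rat].
by apply/negP => /ltW /(ratr_le_algC_to_real x0); rewrite leNgt lt_xq.
Qed.

Lemma algC_to_real_nat (k : nat) : toR k%:R = k%:R.
Proof.
apply/eqP; rewrite eq_le -(ratr_nat algC) -!(ratr_nat R).
by rewrite algC_to_real_le_ratr ?ratr_le_algC_to_real // ler0q.
Qed.

Lemma algC_to_real_ge1 (x : algC) : 1 <= x -> 1 <= toR x.
Proof.
move=> x1; have := @ratr_le_algC_to_real x 1 (le_trans ler01 x1).
by rewrite !rmorph1; apply.
Qed.

(** Otherwise some rational [q] above the real number [toR x] would still satisfy
[b * q^k < a]; but [x <= q] in [algC], and the order of the rationals is the same
on both sides. *)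
Lemma algC_to_real_exp_le (x : algC) (a b k : nat) : 1 <= x ->
  a%:R <= b%:R * x ^+ k -> a%:R <= b%:R * toR x ^+ k.
Proof.
move=> x1 le_a; have x0 := le_trans ler01 x1.
have tx1 := algC_to_real_ge1 x1; have tx0 := le_trans ler01 tx1.
rewrite leNgt; apply/negP => lt_a.
have [b0|b_gt0] := posnP b.
  by move: le_a lt_a; rewrite b0 !mul0r lern0 ltr0n => /eqP->.
have [k0|k_gt0] := posnP k.
  move: le_a lt_a; rewrite k0 !expr0 !mulr1 !ler_nat ltr_nat => le_ab.
  by rewrite ltnNge le_ab.
have bR : 0 < b%:R :> R by rewrite ltr0n.
pose t := (a%:R / b%:R : R) `^ k%:R^-1.
have ab0 : 0 <= a%:R / b%:R :> R by rewrite divr_ge0.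
have tk : t ^+ k = a%:R / b%:R.
  rewrite -powR_mulrn ?powR_ge0 // /t -powRrM mulVf ?powRr1 // pnatr_eq0 -lt0n //.
have lt_xt : toR x < t.
  rewrite -(ltr_pXn2r k_gt0) ?nnegrE ?powR_ge0 // tk ltr_pdivlMr //.
  by rewrite mulrC.
have [q] := rat_in_itvoo lt_xt; rewrite in_itv /= => /andP[lt_xq lt_qt].
have le_xq := le_ratr_of_algC_to_real_lt x0 lt_xq.
have q0 : 0 <= q by rewrite -(ler0q R) (le_trans tx0) // ltW.
have : a%:R <= b%:R * (ratr q) ^+ k :> algC.
  by apply: le_trans le_a _; rewrite ler_wpM2l // lerXn2r // nnegrE // ler0q.
rewrite -(ratr_nat algC a) -(ratr_nat algC b) -rmorphXn -rmorphM ler_rat.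
rewrite -(ler_rat R) rmorphM rmorphXn /= !ratr_nat leNgt => /negP; apply.
rewrite mulrC -ltr_pdivlMr // -tk ltr_pXn2r // nnegrE ?powR_ge0 //.
by rewrite ler0q.
Qed.

End Embedding.

Section HeightBounds.
Variable R : realType.

Lemma algdeg_gt0 (a : algC) : (0 < algdeg a)%N.
Proof. by rewrite /algdeg -ltnS prednK ?size_minCpoly // (leq_trans _ (size_minCpoly a)). Qed.

Lemma weil_height_ge0 (a : algC) : 0 <= weil_height R a.
Proof.
by rewrite divr_ge0 // ln_ge0 // algC_to_real_ge1 // mahler_ge1.
Qed.

Lemma ln_fact_le (n : nat) : ln ((n`!)%:R : R) <= n%:R * ln n%:R.
Proof.
case: n => [|n]; first by rewrite mul0r ln1.
rewrite mulr_natl -lnXn ?ltr0n // ler_ln ?posrE ?ltr0n ?fact_gt0 ?exprn_gt0 ?ltr0n //.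
rewrite -natrX ler_nat fact_prod -[X in (_ <= _ ^ X)%N](subn1 n.+2) -prod_nat_const_nat.
by rewrite !big_nat; apply: leq_prod => i /andP[_].
Qed.

(** The hypothesis is the conclusion of [radical_step]; take logarithms and bound
[log d!] by [d log d]. *)
Lemma weil_height_ge (a : algC) (d p : nat) :
    (1 < d)%N -> (0 < p)%N ->
    p%:R ^+ (algdeg a * d.-1) <=
      ((d`!)%:R ^+ algdeg a * mahler a ^+ (d * d.-1)) ^+ 2 ->
  ln (p%:R : R) / (2 * d%:R) - ln d%:R / (d.-1)%:R <= weil_height R a.
Proof.
move=> d_gt1 p_gt0; set n := algdeg a; rewrite [leRHS]exprMn -!exprM -!natrX.
move/(algC_to_real_exp_le R (mahler_ge1 a)); rewrite /weil_height -/n.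
have := algC_to_real_ge1 R (mahler_ge1 a); set x := algC_to_real R _ => x1 le_p.
have x0 : 0 < x by apply: lt_le_trans x1.
have n0 : 0 < n%:R :> R by rewrite ltr0n algdeg_gt0.
have d0 : 0 < d%:R :> R by rewrite ltr0n ltnW.
have d'0 : 0 < d.-1%:R :> R by rewrite ltr0n -ltnS prednK // ltnW.
have := ln_fact_le d; set lf := ln _; set ld := ln d%:R => le_lf.
have : ln (p%:R : R) *+ (n * d.-1) <= lf *+ (n * 2) + ln x *+ (d * d.-1 * 2).
  have f0 : 0 < (d`!)%:R :> R by rewrite ltr0n fact_gt0.
  rewrite /lf -(lnXn _ f0) -(lnXn _ x0) -lnXn ?ltr0n // -lnM ?posrE ?exprn_gt0 // ler_ln ?posrE ?mulr_gt0 ?exprn_gt0 ?ltr0n //.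
  - by rewrite -!natrX.
  - exact: fact_gt0.
rewrite -(mulr_natr (ln _)) -(mulr_natr lf) -(mulr_natr (ln x)) !natrM; set lp := ln p%:R => le_lp.
rewrite -subr_ge0.
have -> : ln x / n%:R - (lp / (2 * d%:R) - ld / d.-1%:R) =
  (2 * d%:R * d.-1%:R * ln x - n%:R * d.-1%:R * lp + 2 * d%:R * n%:R * ld) / (2 * d%:R * d.-1%:R * n%:R).
  field. by rewrite !gt_eqF.
rewrite divr_ge0 ?mulr_ge0 ?(ltW n0) ?(ltW d0) ?(ltW d'0) //.
have := ler_wpM2l (mulr_ge0 (ler0n R 2) (ltW n0)) le_lf.
lra.
Qed.
End HeightBounds.

(** * Finiteness for bounded degree and height *)

Lemma coef_prod_XsubC_le (R : numDomainType) (s : seq R) (k : nat) :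
  `|(\prod_(b <- s) ('X - b%:P))`_k| <= 2 ^+ size s * \prod_(b <- s) Num.max 1 `|b|.
Proof.
elim: s k => [|b s IH] k; first by rewrite !big_nil coef1 mul1r; case: eqP; rewrite ?normr1 ?normr0.
rewrite !big_cons mulrBl coefB coefCM coefXM.
set P := \prod_(b0 <- s) ('X - _) in IH *; set M := \prod_(b0 <- s) Num.max _ _ in IH *.
have M0 : 0 <= 2 ^+ size s * M by apply: le_trans (normr_ge0 _) (IH 0).
apply: le_trans (ler_normB _ _) _; rewrite normrM /= exprS.
have -> : 2 * 2 ^+ size s * (Num.max 1 `|b| * M) =
    Num.max 1 `|b| * (2 ^+ size s * M) + Num.max 1 `|b| * (2 ^+ size s * M) by ring.
apply: lerD; last by apply: ler_pM => //; rewrite max1_norm.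
case: eqP => _; last by apply: le_trans (IH _) _; rewrite ler_peMl // max1_norm.
by rewrite normr0 mulr_ge0 // (le_trans ler01) // max1_norm.
Qed.

Lemma coef_int_minpoly_le (a : algC) (k : nat) :
  `|((int_minpoly a)`_k)%:~R| <= 2 ^+ algdeg a * mahler a.
Proof.
have [Dg _ g_gt0] := int_minpolyE a.
have -> : ((int_minpoly a)`_k)%:~R = (map_poly (intr : int -> algC) (int_minpoly a))`_k.
  by rewrite coef_map.
rewrite Dg minCpoly_conjugates coefZ normrM ger0_norm; last by rewrite ler0z ltW.
rewrite /mahler mulrCA -size_conjugates; apply: ler_wpM2l; first by rewrite ler0z ltW.
exact: coef_prod_XsubC_le.
Qed.

(** Such an algebraic number is a root of one of the finitely many integer
polynomials of degree at most [N] with coefficients of size at most [2^N * H]. *)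
Lemma finite_bounded_mahler (N H : nat) :
  finite_set [set a : algC | (algdeg a <= N)%N /\ mahler a <= H%:R].
Proof.
pose M := (2 ^ N * H)%N.
(* The coefficients are encoded by naturals at most [2 * M], shifted by [M]. *)
pose poly_of (f : {ffun 'I_N.+1 -> 'I_(2 * M).+1}) : {poly algC} :=
  \poly_(k < N.+1) (f (inord k))%:R - \poly_(k < N.+1) M%:R.
pose roots_of f := sval (closed_field_poly_normal (poly_of f)).
apply: (@sub_finite_set _ _ [set` flatten [seq roots_of f | f <- enum {: {ffun 'I_N.+1 -> 'I_(2 * M).+1}}]]); last first.
  exact: finite_seq.
move=> a /= [le_aN le_aH]; have [Dg _ g_gt0] := int_minpolyE a; have g_small := coef_int_minpoly_le a.
move: (int_minpoly a) Dg g_gt0 g_small => g Dg g_gt0 g_small.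
pose coef_g k := g`_k.
have g_le k : (absz (coef_g k) <= M)%N.
  rewrite -(ler_nat algC) /M natrM natrX natr_absz intr_norm.
  apply: le_trans (g_small k) _.
  apply: ler_pM => //.
    exact: le_trans ler01 (mahler_ge1 a).
  by rewrite ler_weXn2l // ler1n.
pose f := [ffun k : 'I_N.+1 => inord (absz (coef_g k + M%:Z)) : 'I_(2 * M).+1].
have Df : poly_of f = map_poly (intr : int -> algC) g.
  apply/polyP=> k; rewrite coef_map coefB !coef_poly /=; case: ltnP => [lt_kN|le_Nk].
    rewrite ffunE [X in coef_g X]inordK // inordK; last by have := g_le k; lia.
    rewrite natr_absz ger0_norm; last by have := g_le k; lia.
    by rewrite intrD -pmulrn addrK.
  rewrite subr0 nth_default // (leq_trans _ le_Nk) //.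
  have := congr1 (fun q : {poly algC} => size q) Dg.
  rewrite size_map_inj_poly ?rmorph0 //; last exact: intr_inj.
  rewrite size_scale ?intr_eq0 ?gt_eqF // => ->.
  by rewrite -(ltn_predK (size_minCpoly a)).
apply/flattenP; exists (roots_of f); first by apply/mapP; exists f; rewrite ?mem_enum.
have : root (poly_of f) a by rewrite Df Dg rootZ ?root_minCpoly // intr_eq0 gt_eqF.
rewrite /roots_of; case: closed_field_poly_normal => s /= {1}->.
rewrite rootZ ?root_prod_XsubC // lead_coef_eq0 Df map_poly_eq0_id0 ?intr_eq0.
  by rewrite -lead_coef_eq0 gt_eqF.
by rewrite gt_eqF.
Qed.

Lemma algdeg_le_dim (L : fieldExtType rat) (emb : {rmorphism L -> algC}) (x : L) :
  (algdeg (emb x) <= \dim {:L})%N.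
Proof.
have /polyOver1P[q Dq] := minPolyOver 1 x.
have q0 : q != 0.
  by rewrite -(map_poly_eq0 (in_alg L)) -Dq monic_neq0 ?monic_minPoly.
have qx0 : root (map_poly ratr q) (emb x).
  have := root_minPoly 1 x; rewrite Dq -(fmorph_root emb) -map_poly_comp.
  by rewrite (eq_map_poly (g := ratr)) => // b; rewrite /= rmorphZ_num rmorph1 mulr1.
have [q1 [D1 _] dv_q1] := minCpolyP (emb x).
have : (size q1 <= size q)%N by rewrite dvdp_leq // -dv_q1.
rewrite /algdeg D1 size_map_poly -(size_map_poly (in_alg L) q) -Dq size_minPoly.
rewrite adjoin_degreeE dimv1 divn1 => le_q1; rewrite -ltnS.
apply: leq_ltn_trans (_ : _ <= \dim <<1; x>>)%N _; last by rewrite ltnS dimvS ?subvf.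
by case: (size q1) le_q1.
Qed.

Lemma radical_field_algdeg (r : nat -> algC) (n : nat) :
  exists N, forall a, radical_field r n a -> (algdeg a <= N)%N.
Proof.
have [L [emb [ts Dts _]]] := num_field_exists [seq r j | j <- iota 0 n].
exists (\dim {:L}) => a.
by case/(mem_generated_field _ (range_map_iota Dts)) => y _ ->; apply: algdeg_le_dim.
Qed.

Section Northcott.
Variable R : realType.

Lemma weil_height_le_height_gamma (gamma : R) (a : algC) : 0 <= gamma ->
  weil_height R a <= height_gamma gamma a.
Proof.
move=> g0; rewrite /height_gamma ler_peMl ?weil_height_ge0 //.
apply: (@le_trans _ _ ((algdeg a)%:R `^ 0)); first by rewrite powRr0.
by rewrite ler_powR // ler1n algdeg_gt0.
Qed.

Lemma finite_bounded_height (gamma X : R) (r : nat -> algC) (n : nat) : 0 <= gamma ->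
  finite_set [set a | radical_field r n a /\ height_gamma gamma a < X].
Proof.
move=> g0; have [N leN] := radical_field_algdeg r n.
pose H := Num.bound (expR (`|X| * N%:R)).
apply: sub_finite_set (finite_bounded_mahler N H) => a [/leN le_aN lt_aX]; split=> //.
rewrite -(ratr_nat algC); apply: (@le_ratr_of_algC_to_real_lt R).
  exact: le_trans ler01 (mahler_ge1 a).
rewrite ratr_nat; apply: le_lt_trans (archi_boundP (expR_ge0 _)).
have := algC_to_real_ge1 R (mahler_ge1 a); set x := algC_to_real R _ => x1.
have x0 : 0 < x by apply: lt_le_trans x1.
rewrite -[x]lnK ?posrE // ler_expR.
have := le_lt_trans (weil_height_le_height_gamma a g0) lt_aX.
rewrite /weil_height -/x ltr_pdivrMr ?ltr0n ?algdeg_gt0 // => /ltW lt_x.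
apply: le_trans lt_x _; apply: le_trans (ler_norm _) _.
by rewrite normrM [`|_%:R|]ger0_norm // ler_wpM2l // ler_nat.
Qed.
End Northcott.

(** * Heights of radicals *)

Lemma minCpoly_radical (a : algC) (d p : nat) :
    (0 < d)%N -> a ^+ d = p%:R -> (d <= algdeg a)%N -> minCpoly a = 'X^d - p%:R%:P.
Proof.
move=> d_gt0 a_root le_d; have [q [D mon_q] dv_q] := minCpolyP a.
pose f : {poly rat} := 'X^d - p%:R%:P.
have Df : map_poly ratr f = 'X^d - p%:R%:P :> {poly algC}.
  by rewrite rmorphB /= map_polyXn map_polyC /= rmorph_nat.
have qf : q %| f by rewrite -dv_q Df rootE !hornerE a_root subrr.
have szf : size f = d.+1 by rewrite size_XnsubC.
have : q %= f.
  rewrite -(dvdp_size_eqp qf) eqn_leq dvdp_leq //=; last by rewrite -size_poly_eq0 szf.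
  by rewrite szf -(size_map_poly (ratr : rat -> algC)) -D -(ltn_predK (size_minCpoly a)) ltnS.
by rewrite eqp_monic ?monicXnsubC // => /eqP Dq; rewrite D Dq Df.
Qed.

(** The roots of [X^d - p] have absolute value at least 1, so the product of the
[Num.max 1] is the absolute value of the constant term. *)
Lemma mahler_radical (a : algC) (d p : nat) :
    (0 < d)%N -> (0 < p)%N -> a ^+ d = p%:R -> (d <= algdeg a)%N -> mahler a = p%:R.
Proof.
move=> d_gt0 p_gt0 a_root le_d; have Da := minCpoly_radical d_gt0 a_root le_d.
have [Dg g1 _] := int_minpolyE a; rewrite /mahler.
have -> : lead_coef (int_minpoly a) = 1.
  move: (int_minpoly a) Dg g1 => g Dg g1.
  have Eg : g = lead_coef g *: ('X^d - p%:Z%:P).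
    apply: (map_inj_poly (f := intr : int -> algC)); [exact: intr_inj | by rewrite rmorph0 |].
    by rewrite {1}Dg Da map_polyZ rmorphB /= map_polyXn map_polyC.
  by rewrite -g1 {2}Eg zcontentsZ zcontents_monic ?mulr1 // monicXnsubC.
rewrite mul1r (eq_big_seq (fun b => `|b|)) => [|b].
  rewrite -normr_prod; have := congr1 (fun f : {poly algC} => `|f.[0]|) (minCpoly_conjugates a).
  rewrite Da horner_prod !hornerE expr0n eqn0Ngt d_gt0 sub0r normrN normr_nat => ->.
  rewrite !normr_prod; apply: eq_bigr => b _.
  by rewrite !hornerE ?sub0r normrN.
rewrite -root_prod_XsubC -minCpoly_conjugates Da rootE !hornerE subr_eq0 => /eqP b_root.
have b1 : 1 <= `|b|.
  by rewrite -(expr_ge1 d_gt0) // -normrX b_root normr_nat ler1n.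
by apply/max_idPr.
Qed.

Lemma algdeg_radical (a : algC) (d p : nat) :
    (0 < d)%N -> a ^+ d = p%:R -> (d <= algdeg a)%N -> algdeg a = d.
Proof. by move=> *; rewrite /algdeg (@minCpoly_radical a d p) // size_XnsubC. Qed.

(** * The tower of radical fields *)

Lemma generated_field_mono (A B : set algC) : A `<=` B -> generated_field A `<=` generated_field B.
Proof. by move=> AB x Ax K Kdiv BK; apply: Ax => // a /AB; apply: BK. Qed.

Lemma generated_field_sub (A : set algC) : A `<=` generated_field A.
Proof. by move=> x Ax K _; apply. Qed.

Lemma generated_field_divring (A : set algC) :
  divring_closed (fun x => `[< generated_field A x >] : bool).
Proof.
split=> [|x y /asboolP Ax /asboolP Ay|x y /asboolP Ax /asboolP Ay]; apply/asboolP => K Kdiv AK.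
- by case: (Kdiv) => K1 _ _.
- by case: (Kdiv) => _ KB _; apply: KB; [apply: Ax | apply: Ay].
- by case: (Kdiv) => _ _ KD; apply: KD; [apply: Ax | apply: Ay].
Qed.

Lemma radical_field_mono (r : nat -> algC) (m n : nat) :
  (m <= n)%N -> radical_field r m `<=` radical_field r n.
Proof.
move=> le_mn; apply: generated_field_mono => _ [j /= ltjm <-].
by exists j => //=; apply: leq_trans le_mn.
Qed.

Lemma generated_field_radical (r : nat -> algC) (x : algC) :
  generated_field (range r) x -> exists n, radical_field r n x.
Proof.
pose K : {pred algC} := fun x => `[< exists n, radical_field r n x >].
move=> gen_x; suff /asboolP : x \in K by [].
apply: gen_x => [|_ [j _ <-]]; last first.
  by apply/asboolP; exists j.+1; apply: generated_field_sub; exists j => /=.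
have common u v : u \in K -> v \in K -> exists n, radical_field r n u /\ radical_field r n v.
  move=> /asboolP[m Fu] /asboolP[n Fv]; exists (maxn m n).
  by split; [apply: radical_field_mono Fu; apply: leq_maxl | apply: radical_field_mono Fv; apply: leq_maxr].
have closed n := generated_field_divring [set r j | j in [set j | (j < n)%N]].
split=> [|u v Ku Kv|u v Ku Kv]; apply/asboolP.
- by exists 0%N; case: (closed 0%N) => /asboolP.
- have [n [Fu Fv]] := common _ _ Ku Kv; exists n.
  by case: (closed n) => _ /(_ u v (asboolT Fu) (asboolT Fv)) /asboolP.
- have [n [Fu Fv]] := common _ _ Ku Kv; exists n.
  by case: (closed n) => _ _ /(_ u v (asboolT Fu) (asboolT Fv)) /asboolP.
Qed.

Lemma radical_field_step (r : nat -> algC) (x : algC) (m : nat) :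
    generated_field (range r) x -> ~ radical_field r m x ->
  exists2 i, (m <= i)%N & radical_field r i.+1 x /\ ~ radical_field r i x.
Proof.
case/generated_field_radical => n; elim: n => [|n IH] Fx nFx.
  by case: nFx; apply: radical_field_mono Fx.
case: (pselect (radical_field r n x)) => [Fnx|nFnx]; first exact: IH.
exists n => //; rewrite leqNgt; apply/negP => lt_nm; apply: nFx.
exact: radical_field_mono lt_nm _ Fx.
Qed.

(** * Asymptotics *)

Section Growth.
Variable d : nat -> nat.
Hypothesis (d_prime : forall i, prime (d i)) (d_growth : forall i, (2 * d i <= d i.+1)%N).

Lemma growth_double (i j : nat) : (j < i)%N -> (2 * d j <= d i)%N.
Proof.
elim: i => // i IH; rewrite ltnS leq_eqVlt => /predU1P[->//|/IH le_ji].
by have := d_growth i; lia.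
Qed.

Lemma growth_gt (i : nat) : (i < d i)%N.
Proof.
elim: i => [|i IH]; first exact: prime_gt0.
by have := d_growth i; lia.
Qed.

End Growth.

Section Asymptotics.
Variable R : realType.

Lemma ln_le_powR (x t : R) : 0 < x -> 0 < t -> ln x <= x `^ t / t.
Proof.
move=> x0 t0; rewrite ler_pdivlMr // mulrC -ln_powR.
have y0 : 0 < x `^ t by rewrite powR_gt0.
by have := expR_ge1Dx (ln (x `^ t)); rewrite lnK ?posrE //; lra.
Qed.

Variables (gamma epsilon : R) (d p : nat -> nat).
Hypothesis (gamma01 : 0 <= gamma <= 1) (eps_gt0 : 0 < epsilon).
Hypothesis (d_prime : forall i, prime (d i)) (p_prime : forall i, prime (p i)).
Hypothesis d_growth : forall i, (2 * d i <= d i.+1)%N.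
Local Notation c := (1 - gamma + epsilon / 2).
Hypothesis ln_p : forall i,
  (d i)%:R `^ c <= ln ((p i)%:R : R) <= ln 2 + (d i)%:R `^ c.

Lemma exponent_gt0 : 0 < c. Proof. by move: gamma01 eps_gt0; lra. Qed.

Lemma growth_powR (a x : R) : 0 < a -> exists n, forall i, (n <= i)%N -> x <= (d i)%:R `^ a.
Proof.
move=> a0; pose y := `|x| + 1; have y0 : 0 < y by rewrite ltr_wpDl.
exists (Num.bound (y `^ a^-1)) => i le_i; apply: (@le_trans _ _ y).
  by apply: le_trans (ler_norm x) _; rewrite lerDl.
have -> : y = (y `^ a^-1) `^ a by rewrite -powRrM mulVf ?gt_eqF // powRr1 // ltW.
apply: ge0_ler_powR; rewrite ?nnegrE ?powR_ge0 ?ler0n //; apply: ltW => //.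
apply: lt_le_trans (archi_boundP (powR_ge0 _ _)) _.
by rewrite ler_nat (leq_trans le_i) // ltnW // growth_gt.
Qed.

Lemma d_ge1 i : 1 <= (d i)%:R :> R. Proof. by rewrite ler1n prime_gt0. Qed.
Lemma d_gt0 i : 0 < (d i)%:R :> R. Proof. by rewrite ltr0n prime_gt0. Qed.

(** The exponent [c] is positive, so [(d i)^c] outgrows [log (d i)], which gives
[d i < p i]. As [d i] at least doubles, [(d i)^c] is at least [2^c] times
[(d j)^c], and the excess eventually exceeds the slack [log 2] in the size of
[p j]. *)
Lemma eventually_separated : exists n, forall i, (n <= i)%N ->
  (forall j, (j <= i)%N -> (d j < p i)%N) /\ (forall j, (j < i)%N -> p j != p i).
Proof.
have c0 := exponent_gt0; have c20 : 0 < c / 2 by rewrite divr_gt0.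
have [n1 le1] := growth_powR (2 / c + 1) c20.
have two_c : 2 `^ (- c) < 1 :> R.
  rewrite powRN invf_lt1 ?powR_gt0 //.
  have := @gt0_ltr_powR R c c0 1 2; rewrite !nnegrE powR1; apply => //.
  by rewrite ltr1n.
have [n2 le2] := growth_powR ((ln 2 + 1) / (1 - 2 `^ (- c))) c0.
exists (maxn n1 n2) => i; rewrite geq_max => /andP[/le1 {}le1 /le2 {}le2].
have p0 j : 0 < (p j)%:R :> R by rewrite ltr0n prime_gt0.
split=> j.
  move=> le_ji; apply: (@leq_ltn_trans (d i)).
    by move: le_ji; rewrite leq_eqVlt => /predU1P[->//|/(growth_double d_growth)]; lia.
  rewrite -(ltr_nat R) -ltr_ln ?posrE ?d_gt0 //.
  have /andP[le_p _] := ln_p i; apply: lt_le_trans le_p.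
  apply: le_lt_trans (ln_le_powR (d_gt0 i) c20) _.
  have -> : (d i)%:R `^ c = (d i)%:R `^ (c / 2) * (d i)%:R `^ (c / 2).
    by rewrite -powRD ?(gt_eqF (d_gt0 i)) ?implybT // -splitr.
  rewrite ltr_pM2l ?powR_gt0 ?d_gt0 // invf_div.
  by apply: lt_le_trans le1; rewrite ltrDl.
move=> ltji; apply/eqP => eq_p.
have /andP[le_p _] := ln_p i; have /andP[_] := ln_p j; rewrite eq_p => /(le_trans le_p).
have : (d j)%:R `^ c <= (d i)%:R `^ c * 2 `^ (- c).
  rewrite powRN ler_pdivlMr ?powR_gt0 // -powRM ?ler0n //.
  apply: ge0_ler_powR; rewrite ?nnegrE ?mulr_ge0 ?ler0n ?(ltW c0) //.
  by rewrite -natrM ler_nat mulnC (growth_double d_growth).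
move: le2; rewrite ler_pdivrMr ?subr_gt0 //.
lra.
Qed.

(** With [y = (d i)^(epsilon/4)], the main term is at least [y^2 / 2] and the error
term at most [2 * log (d i)], which is at most [8 * y / epsilon]. *)
Lemma height_gamma_lower (X : R) : exists n, forall i (a : algC), (n <= i)%N ->
    (d i <= algdeg a)%N ->
    ln ((p i)%:R : R) / (2 * (d i)%:R) - ln (d i)%:R / ((d i).-1)%:R <= weil_height R a ->
  X <= height_gamma gamma a.
Proof.
have t0 : 0 < epsilon / 4 by rewrite divr_gt0.
have [n le_n] := growth_powR (2 + 16 / epsilon + `|X|) t0.
exists n => i a /le_n {le_n}; set D := (d i)%:R; set y := D `^ (epsilon / 4) => le_y le_d le_h.
have D0 : 0 < D := d_gt0 i; have D1 : 1 <= D := d_ge1 i.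
have D2 : 2 <= D by rewrite ler_nat prime_gt1.
have D'E : (d i).-1%:R = D - 1 :> R.
  by rewrite /D -[in RHS](prednK (prime_gt0 (d_prime i))) -natr1 addrK.
rewrite /height_gamma; apply: (@le_trans _ _ (D `^ gamma * weil_height R a)); last first.
  apply: ler_wpM2r; first exact: weil_height_ge0.
  have g0 : 0 <= gamma by case/andP: gamma01.
  by apply: ge0_ler_powR; rewrite ?nnegrE ?ler0n ?ler_nat.
apply: le_trans (ler_wpM2l (powR_ge0 D gamma) le_h).
have y0 : 0 < y by rewrite powR_gt0.
have yy : D `^ gamma * D `^ c = D * (y * y).
  transitivity (D `^ 1 * (y * y)); last by rewrite powRr1 // ltW.
  by rewrite /y -!powRD ?(gt_eqF D0) ?implybT //; congr (_ `^ _); field.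
have ln_D : ln D <= 4 * y / epsilon.
  by apply: le_trans (ln_le_powR D0 t0) _; rewrite -/y invf_div mulrA [y * 4]mulrC.
have Dg : D `^ gamma <= D.
  by rewrite -{2}(powRr1 (ltW D0)) ler_powR //; case/andP: gamma01.
have /andP[le_p _] := ln_p i; rewrite -/D in le_p.
rewrite D'E mulrBr; apply: (@le_trans _ _ (y * y / 2 - 8 * y / epsilon)).
  have -> : y * y / 2 - 8 * y / epsilon = y * (y / 2 - 8 / epsilon) by field; rewrite gt_eqF.
  have le_half : 1 + `|X| / 2 <= y / 2 - 8 / epsilon.
    have E16 : 16 / epsilon = 2 * (8 / epsilon) by field; rewrite gt_eqF.
    by move: le_y; rewrite E16; lra.
  have y2 : 2 <= y.
    apply: le_trans le_y; rewrite -addrA lerDl addr_ge0 ?normr_ge0 // divr_ge0 // ltW //.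
  have := ler_norm X; have := normr_ge0 X; nra.
apply: lerB.
  have -> : y * y / 2 = D `^ gamma * (D `^ c / (2 * D)).
    rewrite mulrA yy; field; by rewrite gt_eqF.
  by rewrite ler_wpM2l ?powR_ge0 // ler_wpM2r // invr_ge0 mulr_ge0 // ltW.
have ln_D0 : 0 <= ln D by rewrite ln_ge0.
apply: (@le_trans _ _ (D * (ln D / (D - 1)))).
  by rewrite ler_wpM2r // divr_ge0 // subr_ge0.
rewrite mulrA ler_pdivrMr ?subr_gt0 ?(lt_le_trans _ D2) ?ltr1n //.
have : 8 * y / epsilon = 2 * (4 * y / epsilon) by field; rewrite gt_eqF.
by move=> ->; nra.
Qed.

(** As [(d i)^c >= 1], the logarithm of [p i] is at most [(log 2 + 1) * (d i)^c], and
the powers of [d i] combine to the exponent [- epsilon / 2]. *)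
Lemma height_gamma_upper (delta : R) : 0 < delta -> exists n, forall i (a : algC), (n <= i)%N ->
    algdeg a = d i -> mahler a = (p i)%:R ->
  height_gamma (gamma - epsilon) a < delta.
Proof.
move=> del0; have e20 : 0 < epsilon / 2 by rewrite divr_gt0.
have ln20 : 0 <= ln 2 :> R by rewrite ln_ge0 // ler1n.
have [n le_n] := growth_powR ((ln 2 + 1) / delta + 1) e20.
exists n => i a /le_n {le_n}; rewrite /height_gamma /weil_height => le_n -> ->.
rewrite algC_to_real_nat; set D := (d i)%:R in le_n *.
have D0 : 0 < D := d_gt0 i; have D1 : 1 <= D := d_ge1 i.
have /andP[_ le_p] := ln_p i; rewrite -/D in le_p.
have c1 : 1 <= D `^ c.
  apply: (@le_trans _ _ (D `^ 0)); first by rewrite powRr0.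
  by apply: ler_powR => //; apply/ltW/exponent_gt0.
have y0 : 0 < D `^ (epsilon / 2) by rewrite powR_gt0.
apply: (@le_lt_trans _ _ ((ln 2 + 1) / D `^ (epsilon / 2))).
  have -> : (ln 2 + 1) / D `^ (epsilon / 2) = D `^ (gamma - epsilon) * ((ln 2 + 1) * D `^ c / D).
    have <- : D `^ (gamma - epsilon) * (D `^ c / D) = (D `^ (epsilon / 2))^-1.
      rewrite -powRN -[D^-1]powR_inv1 ?(ltW D0) //.
      by rewrite -!powRD ?(gt_eqF D0) ?implybT //; congr (_ `^ _); field.
    ring.
  rewrite ler_wpM2l ?powR_ge0 // ler_wpM2r ?invr_ge0 ?(ltW D0) //.
  apply: le_trans le_p _; rewrite mulrDl mul1r lerD2r ler_peMr //.
rewrite ltr_pdivrMr // mulrC -ltr_pdivrMr //.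
by apply: lt_le_trans le_n; rewrite ltrDl.
Qed.
End Asymptotics.

(** * Conclusion *)

Lemma northcott_number_infinite (R : realType) (f : algC -> R) (S : set algC) :
    (forall X, finite_set [set a | S a /\ f a < X]) ->
  northcott_number f S = +oo%E.
Proof.
move=> fin; rewrite /northcott_number; set A := [set X | _].
suff -> : A = set0 by rewrite image_set0 ereal_inf0.
by apply/seteqP; split=> // X [_]; apply; apply: fin.
Qed.

Lemma northcott_number_le0 (R : realType) (f : algC -> R) (S : set algC) :
    (forall X, 0 < X -> infinite_set [set a | S a /\ f a < X]) ->
  (northcott_number f S <= 0)%E.
Proof.
move=> inf; apply/lee_addgt0Pr => X X_gt0; rewrite add0e.
by apply: ereal_inf_lbound; exists X => //; split; [exact: ltW | exact: inf].
Qed.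

Unset Implicit Arguments.

Theorem theorem4 (R : realType) (gamma epsilon : R)
  (hgamma : 0 <= gamma <= 1) (hepsilon : 0 < epsilon)
  (d p : nat -> nat)
  (hd : forall i, prime (d i)) (hp : forall i, prime (p i))
  (hgrowth : forall i, (2 * d i <= d i.+1)%N)
  (hsize : forall i,
    (d i)%:R `^ (1 - gamma + epsilon / 2) <= ln ((p i)%:R : R)
      <= ln 2 + (d i)%:R `^ (1 - gamma + epsilon / 2))
  (r : nat -> algC) (hr : forall i, r i ^+ d i = (p i)%:R) :
  Northcott gamma (generated_field (range r)) /\
  ~ Bogomolov (gamma - epsilon) (generated_field (range r)).
Proof.
have [n0 sep] := eventually_separated hgamma hepsilon hd hp hgrowth hsize.
have step i (le_i : (n0 <= i)%N) (a : algC) := radical_step hd hp hr (sep i le_i).1 (sep i le_i).2 (alpha := a).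
split.
  apply: northcott_number_infinite => X.
  have [n1 lower] := height_gamma_lower hgamma hepsilon hd hgrowth hsize X.
  have g0 : 0 <= gamma by case/andP: hgamma.
  apply: sub_finite_set (finite_bounded_height X r (maxn n0 n1) g0) => a [Ka lt_aX].
  split=> //; apply: contrapT => nFa.
  have [i] := radical_field_step Ka nFa; rewrite geq_max => /andP[le_0i le_1i] [Fa nFia].
  have [le_d le_p] := step i le_0i a Fa nFia.
  have : X <= height_gamma gamma a.
    by apply: lower le_1i le_d _; apply: weil_height_ge le_p; rewrite ?prime_gt1 ?prime_gt0.
  by rewrite leNgt lt_aX.
apply/negP; rewrite -leNgt; apply: northcott_number_le0 => X X_gt0.
have [n1 upper] := height_gamma_upper hgamma hepsilon hd hgrowth hsize X_gt0.
pose n := maxn n0 n1.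
have deg_r (k : nat) : (d (n + k) <= algdeg (r (n + k)))%N.
  have le_0 : (n0 <= n + k)%N by rewrite (leq_trans (leq_maxl n0 n1)) ?leq_addr.
  case: (step (n + k)%N le_0 (r (n + k)%N)) => //.
    by apply: generated_field_sub; exists (n + k)%N => /=.
  exact: radical_notin hd hp hr (sep _ le_0).1 (sep _ le_0).2.
have eq_deg (k : nat) : algdeg (r (n + k)%N) = d (n + k)%N.
  by apply: algdeg_radical (hr _) (deg_r k); apply: prime_gt0.
set A := [set a | _] => finA.
have : finite_set ((fun k => r (n + k)%N) @^-1` A).
  apply: finite_preimage finA => k l _ _ /(congr1 algdeg); rewrite !eq_deg.
  have [ltkl|ltlk|//] := ltngtP k l.
    have := @growth_double d hgrowth (n + l)%N (n + k)%N; rewrite ltn_add2l ltkl => /(_ isT).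
    by have := prime_gt0 (hd (n + k)%N); lia.
  have := @growth_double d hgrowth (n + k)%N (n + l)%N; rewrite ltn_add2l ltlk => /(_ isT).
  by have := prime_gt0 (hd (n + l)%N); lia.
rewrite (_ : _ @^-1` _ = [set: nat]); first exact: infinite_nat.
apply/seteqP; split=> // k _; split; last first.
  apply: upper (eq_deg k) _; first by rewrite (leq_trans (leq_maxr n0 n1)) ?leq_addr.
  by apply: mahler_radical (hr _) (deg_r k); apply: prime_gt0.
split; first by apply: generated_field_sub; exists (n + k)%N.
case=> m [m_gt0 /(congr1 (fun x => x ^+ d (n + k)%N))]; rewrite exprAC hr expr1n => /eqP.
rewrite -natrX pnatr_eq1 => /eqP pm1.
have := prime_gt1 (hp (n + k)%N); rewrite -(ltn_exp2r _ _ m_gt0) exp1n pm1.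
by rewrite ltnn.
Qed.
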